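(* Let $\Gamma$ be a countable group, let $\bm{a}=\Gamma\curvearrowright^a(Y,\nu)$ be a non-atomic measure preserving action of $\Gamma$ of type $\theta\in\mathrm{IRS}(\Gamma)$, let $(Z,\eta)$ be a standard probability space, and let $\bm{s}_{\theta,\eta}$ be the $\theta$-random Bernoulli shift of $\Gamma$ over $(Z,\eta)$. Then the relatively independent joining of $\bm{s}_{\theta,\eta}$ and $\bm{a}$ over their common factor $\Gamma\curvearrowright(\mathrm{Sub}(\Gamma),\theta)$ is weakly equivalent to $\bm{a}$. In particular, $\bm{s}_{\theta,\eta}$ is weakly contained in every non-atomic measure preserving action of $\Gamma$ of type $\theta$.
   Context: A measure preserving action $\bm{a}=\Gamma\curvearrowright^a(Y,\nu)$ of a countable group $\Gamma$ is a Borel action $a$ of $\Gamma$ on a standard Borel space $Y$ preserving a Borel probability measure $\nu$ on $Y$; it is non-atomic if $(Y,\nu)$ is non-atomic. Weak containment: for $\bm{a}$ on $(X,\mu)$ and $\bm{b}$ on $(Y,\nu)$, $\bm{a}\prec\bm{b}$ means that for every finite Borel partition $A_0,\dots,A_{k-1}$ of $X$, every finite $F\subseteq\Gamma$, and every $\epsilon>0$ there is a Borel partition $B_0,\dots,B_{k-1}$ of $Y$ with $|\mu(\gamma^aA_i\cap A_j)-\nu(\gamma^bB_i\cap B_j)|<\epsilon$ for all $\gamma\in F$ and $i,j<k$. Weak equivalence means $\bm{a}\prec\bm{b}$ and $\bm{b}\prec\bm{a}$. $\mathrm{Sub}(\Gamma)\subseteq2^\Gamma$ is the compact space of subgroups of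 $\Gamma$, on which $\Gamma$ acts by conjugation $\gamma\cdot H=\gamma H\gamma^{-1}$. $\mathrm{IRS}(\Gamma)$ is the set of conjugation-invariant Borel probability measures on $\mathrm{Sub}(\Gamma)$. The type of $\bm{a}=\Gamma\curvearrowright^a(Y,\nu)$ is $\mathrm{type}(\bm{a})=(\mathrm{stab}_a)_*\nu\in\mathrm{IRS}(\Gamma)$, where $\mathrm{stab}_a(y)=\Gamma_y=\{\gamma:\gamma^ay=y\}$. Random Bernoulli shift: let $Z^{\leq\backslash\Gamma}=\bigsqcup_{H\in\mathrm{Sub}(\Gamma)}Z^{H\backslash\Gamma}$, where $H\backslash\Gamma$ is the set of right cosets of $H$; for $f\in Z^{H\backslash\Gamma}$ put $H_f=H$. Its Borel structure is inherited from $Z^\Gamma\times\mathrm{Sub}(\Gamma)$ via the injection $f\mapsto((\gamma\mapsto f(H_f\gamma)),H_f)$. $\Gamma$ acts on $Z^{\leq\backslash\Gamma}$ by $s$, where $H_{\gamma^sf}=\gamma H_f\gamma^{-1}$ and $(\gamma^sf)(\gamma H_f\gamma^{-1}\delta)=f(H_f\gamma^{-1}\delta)$. The measure $\eta^{\theta\backslash\Gamma}=\int\eta^{H\backslash\Gamma}\,d\theta(H)$ (with $\eta^{H\backslash\Gamma}$ the product measure on $Z^{H\backslash\Gamma}$) is $s$-invariant, and $\bm{s}_{\theta,\eta}=\Gamma\curvearrowright^s(Z^{\leq\backslash\Gamma},\eta^{\theta\backslash\Gamma})$. The map $f\mapsto H_f$ factors $\bm{s}_{\theta,\eta}$ onto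 $\Gamma\curvearrowright(\mathrm{Sub}(\Gamma),\theta)$, and $y\mapsto\Gamma_y$ factors $\bm{a}$ onto it. The relatively independent joining of $\bm{s}_{\theta,\eta}$ and $\bm{a}$ over these factor maps is the diagonal action $s\times a$ on $Z^{\leq\backslash\Gamma}\times Y$ with the measure $\int_{Y}\eta^{\Gamma_y\backslash\Gamma}\times\delta_y\,d\nu(y)$. *)

(* Defs.v *)
From HB Require Import structures.
From mathcomp Require Import all_boot all_order all_algebra.
From mathcomp Require Import all_classical all_reals all_analysis.
From mathcomp Require Import measurable_realfun.

Set Implicit Arguments.
Unset Strict Implicit.
Unset Printing Implicit Defensive.
Import Order.TTheory GRing.Theory Num.Theory.
Import numFieldNormedType.Exports.

Local Open Scope classical_set_scope.
Local Open Scope ring_scope.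

Section image_probability.
Context d d' (T : measurableType d) (T' : measurableType d') (R : realType).
Variables (P : probability T R) (f : T -> T') (mf : measurable_fun setT f).

Definition image_prob of measurable_fun setT f : set T' -> \bar R :=
  pushforward P f.

Let pf : {measure set T' -> \bar R} :=
  measure_function_pushforward__canonical__measure_function_Measure P mf.

HB.instance Definition _ := isMeasure.Build _ _ _ (image_prob mf)
  (measure0 pf) (measure_ge0 pf) (@measure_semi_sigma_additive _ _ _ pf).

Let image_probT : image_prob mf setT = 1%E.
Proof. exact: probability_setT. Qed.

HB.instance Definition _ :=
  Measure_isProbability.Build _ _ _ (image_prob mf) image_probT.

End image_probability.

(* T^I, with the product sigma-algebra *)
Definition fspace (I T : Type) := I -> T.
HB.instance Definition _ (I : Type) (T : pointedType) :=
  Pointed.copy (fspace I T) (I -> T).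

Definition fspace_cylinders I d (T : measurableType d) :
    set (set (fspace I T)) :=
  [set A | exists i B, measurable B /\ A = [set f : fspace I T | B (f i)]].

Definition fspace_display (d : measure_display) : measure_display.
Proof. exact. Qed.

Section fspace_measurable.
Variables (I : Type) (d : measure_display) (T : measurableType d).
Let G : set (set (fspace I T)) := @fspace_cylinders I d T.

HB.instance Definition _ := @isMeasurable.Build (fspace_display d) (fspace I T)
  <<s G >> (@sigma_algebra0 _ setT G) (@sigma_algebraC _ G)
  (@sigma_algebra_bigcup _ setT G).

End fspace_measurable.

Lemma fspace_measurable_proj (I : Type) d (T : measurableType d) (i : I) :
  measurable_fun setT (fun f : fspace I T => f i).
Proof.
by move=> _ B mB; rewrite setTI; apply: sub_sigma_algebra; exists i, B.
Qed.

Lemma fspace_measurable_fun (I : Type) d (T : measurableType d)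
    d' (X : measurableType d') (g : X -> fspace I T) :
  (forall i, measurable_fun setT (fun x => g x i)) -> measurable_fun setT g.
Proof.
move=> mg; apply: (measurability (@fspace_cylinders I d T)) => //.
move=> _ [_ [i [B [mB ->]]] <-]; rewrite setTI.
by rewrite -[X in measurable X]setTI; exact: mg.
Qed.

Section iid.
Context d (Z : measurableType d) (R : realType) (eta : probability Z R).
Local Notation W := (fspace nat Z).
Local Open Scope ereal_scope.

Definition scons (zf : Z * W) : W := fun n => if n is m.+1 then zf.2 m else zf.1.

Lemma measurable_scons : measurable_fun setT scons.
Proof.
apply: fspace_measurable_fun => -[|n] /=; first exact: measurable_fst.
exact: (measurableT_comp (@fspace_measurable_proj nat _ Z n) measurable_snd).
Qed.

(* law of (z_0, ..., z_(n-1), point, point, ...) *)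
Fixpoint finlaw (n : nat) : probability W R :=
  if n is m.+1 then image_prob (eta \x (finlaw m)) measurable_scons
  else dirac (point : W).

End iid.

Section iid_premeasure.
Context d (Z : measurableType d) (R : realType) (eta : probability Z R).
Local Notation W := (fspace nat Z).
Local Open Scope ereal_scope.

(* A depends on the first n coordinates only *)
Definition lvl n (A : set W) := measurable A /\
  forall f g : W, (forall i, (i < n)%N -> f i = g i) -> A f -> A g.
Definition is_cylinder A := exists n, lvl n A.
Definition ssec (A : set W) (z : Z) : set W := [set f | A (scons (z, f))].

Lemma measurable_scons1 z : measurable_fun setT (fun f : W => scons (z, f)).
Proof.
apply: (measurableT_comp (@measurable_scons d Z)).
by apply: measurable_fun_pair => //; exact: measurable_cst.
Qed.

Lemma lvl_ssec n A z : lvl n.+1 A -> lvl n (ssec A z).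
Proof.
move=> [mA Al]; split.
  by rewrite -[X in measurable X]setTI; exact: measurable_scons1.
by move=> f g fg; apply: Al => -[|i] //= /fg.
Qed.

Lemma xsection_scons A z : xsection (@scons _ Z @^-1` A) z = ssec A z.
Proof. by apply/seteqP; split => f; rewrite /xsection /= inE. Qed.

Lemma finlawS n A : finlaw eta n.+1 A = \int[eta]_z finlaw eta n (ssec A z).
Proof.
rewrite /= /image_prob /pushforward /product_measure1.
by apply: eq_integral => z _ /=; rewrite xsection_scons.
Qed.

Lemma le_lvl n m A : (n <= m)%N -> lvl n A -> lvl m A.
Proof.
by move=> nm [mA lA]; split => // f g fg; apply: lA => i ni; apply: fg;
  exact: leq_trans nm.
Qed.

Lemma finlaw_stable n m A : lvl n A -> (n <= m)%N ->
  finlaw eta m A = finlaw eta n A.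
Proof.
elim: n m A => [|n IH] m A lA nm.
  have [->|A0] := eqVneq A set0; first by rewrite !measure0.
  suff -> : A = setT by rewrite !probability_setT.
  move/set0P: A0 => [f Af]; apply/seteqP; split => // g _.
  by apply: (lA.2 f).
case: m nm => // m nm; rewrite !finlawS; apply: eq_integral => z _.
by apply: IH => //; exact: lvl_ssec.
Qed.

(* the common value of finlaw m A for m large, when A is a cylinder *)
Definition premeas (A : set W) : \bar R :=
  if pselect (is_cylinder A) is left h then finlaw eta (projT1 (cid h)) A else 0.

Lemma premeasE n A : lvl n A -> premeas A = finlaw eta n A.
Proof.
move=> lA; rewrite /premeas; case: pselect => [h|[]]; last by exists n.
case: cid => m /= lm.
by rewrite -(finlaw_stable lA (leq_maxl n m)) -(finlaw_stable lm (leq_maxr n m)).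
Qed.

Lemma cylinder_ssec A z : is_cylinder A -> is_cylinder (ssec A z).
Proof. by move=> [n /(le_lvl (leqnSn n)) lA]; exists n; exact: lvl_ssec. Qed.

Lemma measurable_premeas_ssec A : is_cylinder A ->
  measurable_fun [set: Z] (fun z => premeas (ssec A z)).
Proof.
move=> [n /(le_lvl (leqnSn n)) lA].
have -> : (fun z => premeas (ssec A z)) =
   finlaw eta n \o xsection (@scons _ Z @^-1` A).
  apply/funext => z /=; rewrite xsection_scons; apply: premeasE.
  exact: lvl_ssec.
apply: measurable_fun_xsection.
by rewrite -[X in measurable X]setTI; apply: measurable_scons => //; exact: lA.1.
Qed.

Lemma premeasS A : is_cylinder A -> premeas A = \int[eta]_z premeas (ssec A z).
Proof.
move=> [n /(le_lvl (leqnSn n)) lA]; rewrite (premeasE lA) finlawS.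
by apply: eq_integral => z _; apply/esym/premeasE; exact: lvl_ssec.
Qed.

Lemma premeas0 : premeas set0 = 0.
Proof. by rewrite (@premeasE 0%N) ?measure0//; split. Qed.

Lemma premeas_ge0 A : 0 <= premeas A.
Proof. by rewrite /premeas; case: pselect => // h; case: cid. Qed.

Lemma premeas_le1 A : is_cylinder A -> premeas A <= 1.
Proof.
by move=> [n lA]; rewrite (premeasE lA); apply: probability_le1; exact: lA.1.
Qed.

Lemma cylinder_measurable A : is_cylinder A -> measurable A.
Proof. by move=> [n []]. Qed.

Lemma cylinder0 : is_cylinder set0.
Proof. by exists 0%N; split. Qed.

Lemma cylinderT : is_cylinder setT.
Proof. by exists 0%N; split. Qed.

Lemma cylinderI A B : is_cylinder A -> is_cylinder B -> is_cylinder (A `&` B).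
Proof.
move=> [n lA] [m lB]; exists (maxn n m).
have [mA cA] := le_lvl (leq_maxl n m) lA.
have [mB cB] := le_lvl (leq_maxr n m) lB.
split; first exact: measurableI.
by move=> f g fg [Af Bf]; split; [exact: cA fg _|exact: cB fg _].
Qed.

Lemma cylinderC A : is_cylinder A -> is_cylinder (~` A).
Proof.
move=> [n [mA cA]]; exists n; split; first exact: measurableC.
by move=> f g fg nAf Ag; apply: nAf; apply: cA Ag => i /fg.
Qed.

Lemma cylinderD A B : is_cylinder A -> is_cylinder B -> is_cylinder (A `\` B).
Proof. by move=> cA cB; rewrite setDE; apply: cylinderI => //; exact: cylinderC. Qed.

Lemma cylinderU A B : is_cylinder A -> is_cylinder B -> is_cylinder (A `|` B).
Proof.
move=> cA cB; rewrite -(setCK (A `|` B)) setCU; apply: cylinderC.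
by apply: cylinderI; exact: cylinderC.
Qed.

Lemma premeasU A B : is_cylinder A -> is_cylinder B -> A `&` B = set0 ->
  premeas (A `|` B) = premeas A + premeas B.
Proof.
move=> [n lA] [m lB] AB.
have lA' := le_lvl (leq_maxl n m) lA; have lB' := le_lvl (leq_maxr n m) lB.
have lAB : lvl (maxn n m) (A `|` B).
  split; first by apply: measurableU; [exact: lA.1|exact: lB.1].
  by move=> f g fg [/(lA'.2 _ _ fg)|/(lB'.2 _ _ fg)]; [left|right].
by rewrite (premeasE lA') (premeasE lB') (premeasE lAB) measureU//;
  [exact: lA.1|exact: lB.1].
Qed.

Definition fat (A : nat -> set W) :=
  [/\ forall k, is_cylinder (A k), forall k, A k.+1 `<=` A k &
      exists2 e : R, (0 < e)%R & forall k, e%:E <= premeas (A k)].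

Lemma le_premeas A B : is_cylinder A -> is_cylinder B -> A `<=` B ->
  premeas A <= premeas B.
Proof.
move=> cA cB AB; have -> : B = A `|` (B `\` A) by rewrite setDUK.
rewrite premeasU//; last first.
- by rewrite setDIK.
- exact: cylinderD.
- by rewrite leeDl// premeas_ge0.
Qed.

Lemma fat_ssec A : fat A -> exists z, fat (fun k => ssec (A k) z).
Proof.
move=> [cA dA [e e0 eA]].
pose E k := [set z | (e / 2)%:E <= premeas (ssec (A k) z)].
have mE k : measurable (E k).
  have := measurable_premeas_ssec (cA k).
  move=> /(_ measurableT `[(e/2)%:E, +oo[%classic (emeasurable_itv _)).
  rewrite setTI; congr (measurable _).
  by apply/seteqP; split => z /=; rewrite in_itv/= andbT.
have etaE k : (e / 2)%:E <= eta (E k).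
  have : e%:E <= eta (E k) + (e / 2)%:E.
    apply: (le_trans (eA k)); rewrite premeasS//.
    have -> : eta (E k) + (e / 2)%:E =
        \int[eta]_z ((\1_(E k) z)%:E + (e / 2)%:E).
      rewrite ge0_integralD//=.
      - by rewrite integral_indic// setIT integral_cst//= probability_setT mule1.
      - exact/measurable_EFinP/measurable_indic.
      - by move=> z _; rewrite lee_fin divr_ge0// ltW.
    apply: ge0_le_integral => //=.
    - by move=> z _; exact: premeas_ge0.
    - exact: measurable_premeas_ssec.
    - apply: emeasurable_funD => //.
      exact/measurable_EFinP/measurable_indic.
    move=> z _; rewrite indicE; have [/set_mem Ez|nEz] := boolP (z \in E k).
      rewrite (le_trans (premeas_le1 _))//; first exact: cylinder_ssec.
      by rewrite leeDl// lee_fin divr_ge0// ltW.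
    rewrite add0e ltW// ltNge; apply/negP => ez; move/negP: nEz; apply.
    by rewrite inE.
  rewrite -(fineK (fin_num_measure eta _ (mE k))) -EFinD !lee_fin => h.
  by rewrite -(lerD2r (e / 2)) -splitr.
have niE : nonincreasing_seq E.
  apply/nonincreasing_seqP => k; apply/subsetPset => z /= /le_trans; apply.
  apply: le_premeas; [exact: cylinder_ssec|exact: cylinder_ssec|].
  by move=> f; exact: dA.
have cE : eta \o E @ \oo --> eta (\bigcap_k E k).
  apply: nonincreasing_cvg_mu => //; last exact: bigcapT_measurable.
  by rewrite (le_lt_trans (probability_le1 _ (mE 0%N)))// ltry.
have : (e / 2)%:E <= eta (\bigcap_k E k).
  rewrite -(cvg_lim _ cE)//; apply: lime_ge; first by apply/cvg_ex; eexists; exact: cE.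
  exact: nearW.
have [->|/set0P[z Ez] _] := eqVneq (\bigcap_k E k) set0.
  by rewrite measure0 lee_fin leNgt divr_gt0.
exists z; split=> [k|k f|]; [exact: cylinder_ssec|exact: dA|].
by exists (e / 2)%R; [rewrite divr_gt0|move=> k; exact: Ez].
Qed.

Lemma fat_nonempty A : fat A -> exists w, forall k, A k w.
Proof.
move=> fA.
pose S := {A | fat A}.
pose nxt (s : S) : S := let h := cid (fat_ssec (projT2 s)) in
  exist _ (fun k => ssec (projT1 s k) (projT1 h)) (projT2 h).
pose hd (s : S) : Z := projT1 (cid (fat_ssec (projT2 s))).
pose s n := iter n nxt (exist _ A fA).
pose w : W := fun n => hd (s n).
exists w => k.
have key n : projT1 (s n) k (fun i => w (n + i)%N) = A k w.
  elim: n => [|n <-] //=; rewrite /ssec /=.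
  congr (projT1 (s n) k _); apply/funext => -[|i] /=; first by rewrite addn0.
  by rewrite addnS addSn.
have [cA _ _] := fA; have [n lA] := cA k.
have ln m : lvl (n - m) (projT1 (s m) k).
  elim: m => [|m IH]; first by rewrite subn0.
  rewrite subnS /=; case: (n - m)%N IH => [|p] IH.
    by apply: lvl_ssec; exact: le_lvl IH.
  exact: lvl_ssec.
have [cs _ [e e0 es]] := projT2 (s n).
rewrite -(key n); have := es k.
have [->|/set0P[f sf] _] := eqVneq (projT1 (s n) k) set0.
  by rewrite premeas0 lee_fin leNgt e0.
by apply: (ln n).2 sf => i; rewrite subnn.
Qed.

End iid_premeasure.

Definition cspace (T : Type) := fspace nat T.
Definition cspace_display (d : measure_display) : measure_display.
Proof. exact. Qed.

Section cspace_instance.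
Variables (d : measure_display) (Z : measurableType d).
HB.instance Definition _ := Pointed.on (cspace Z).
HB.instance Definition _ := @isAlgebraOfSets.Build (cspace_display d) (cspace Z)
  (@is_cylinder d Z) (@cylinder0 d Z) (@cylinderU d Z) (@cylinderC d Z).
End cspace_instance.

Section iid.
Context d (Z : measurableType d) (R : realType) (eta : probability Z R).
Local Notation W := (fspace nat Z).
Local Open Scope ereal_scope.
Local Notation m0 := (premeas eta).

Lemma premeas_fin A : is_cylinder A -> m0 A \is a fin_num.
Proof.
move=> cA; rewrite ge0_fin_numE ?premeas_ge0//.
by rewrite (le_lt_trans (premeas_le1 _ cA))// ltry.
Qed.

Lemma premeas_bigsetU (F : nat -> set W) n :
  (forall i, is_cylinder (F i)) -> trivIset setT F ->
  is_cylinder (\big[setU/set0]_(i < n) F i) /\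
  m0 (\big[setU/set0]_(i < n) F i) = \sum_(i < n) m0 (F i).
Proof.
move=> cF tF; elim: n => [|n [IH1 IH2]].
  by rewrite !big_ord0 premeas0; split => //; exact: cylinder0.
rewrite !big_ord_recr/=; split; first exact: cylinderU.
rewrite premeasU// ?IH2//; rewrite -subset0 => w [Uw Fw].
move: Uw; rewrite -bigcup_mkord => -[i /= ni Fiw].
have := @tF i n I I (ex_intro _ w (conj Fiw Fw)).
by move=> ein; move: ni; rewrite ein ltnn.
Qed.

Lemma premeas_sigma_additive : semi_sigma_additive (m0 : set (cspace Z) -> \bar R).
Proof.
move=> F cF tF cU.
pose S n := \big[setU/set0]_(i < n) F i.
pose D n := (\bigcup_i F i) `\` S n.
have cS n : is_cylinder (S n) by have [] := premeas_bigsetU n cF tF.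
have cD n : is_cylinder (D n) by exact: cylinderD.
have DS n : m0 (\bigcup_i F i) = \sum_(0 <= i < n) m0 (F i) + m0 (D n).
  have [_ <-] : is_cylinder (S n) /\ m0 (S n) = \sum_(0 <= i < n) m0 (F i).
    by rewrite big_mkord; exact: premeas_bigsetU.
  rewrite -premeasU//; last by rewrite setDIK.
  congr (m0 _); rewrite /D setDUK// /S -bigcup_mkord.
  by move=> w [i _ Fiw]; exists i.
have sD n : D n.+1 `<=` D n.
  move=> w [Uw nS]; split => // Sw; apply: nS.
  by rewrite /S big_ord_recr /=; left.
have sDm n m : (n <= m)%N -> D m `<=` D n.
  move=> /subnK <-; elim: (m - n)%N => // k IH w.
  by rewrite addSn => /sD /IH.
have D0 : m0 \o D @ \oo --> 0.
  have -> : m0 \o D = EFin \o (fine \o (m0 \o D)).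
    by apply/funext => n /=; rewrite fineK// premeas_fin.
  apply: cvg_EFin; first exact: nearW.
  apply/cvgr0Pnorm_lt => e e0.
  have [N hN] : exists N, m0 (D N) < e%:E.
    apply: contrapT => /forallNP h.
    have [|w Dw] := @fat_nonempty _ _ _ eta D.
      split => //; exists e => // k; rewrite leNgt; apply/negP; exact: h.
    have [[i _ Fiw] _] := Dw 0%N.
    have [_] := Dw i.+1; apply.
    by rewrite /S -bigcup_mkord; exists i => //=.
  exists N => // n /= Nn; rewrite ger0_norm ?fine_ge0 ?premeas_ge0//.
  rewrite -lte_fin fineK ?premeas_fin// (le_lt_trans _ hN)//.
  by apply: le_premeas => //; exact: sDm.
rewrite (_ : (fun n => _) = fun n => m0 (\bigcup_i F i) - m0 (D n)); last first.
  by apply/funext => n; rewrite (DS n) addeK// premeas_fin.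
rewrite -[X in _ --> X]sube0; apply: cvgeB => //.
  by rewrite fin_num_adde_defl//.
exact: cvg_cst.
Qed.

Definition cmeas : set (cspace Z) -> \bar R := m0.
HB.instance Definition _ := isMeasure.Build _ _ _ cmeas
  (premeas0 eta) (premeas_ge0 eta) premeas_sigma_additive.

Lemma fspace_measurableE :
  @measurable _ W = <<s @measurable _ (cspace Z) >>.
Proof.
apply/seteqP; split.
  apply: smallest_sub; first exact: smallest_sigma_algebra.
  move=> _ [i [B [mB ->]]]; apply: sub_sigma_algebra; exists i.+1; split.
    by rewrite -[X in measurable X]setTI; exact: fspace_measurable_proj.
  by move=> f g fg /=; rewrite fg.
apply: smallest_sub; first exact: sigma_algebra_measurable.
by move=> A; exact: cylinder_measurable.
Qed.

(* eta^nat *)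
Definition iid : set W -> \bar R := measure_extension cmeas.

Let iid0 : iid set0 = 0. Proof. exact: measure0. Qed.
Let iid_ge0 A : 0 <= iid A. Proof. exact: measure_ge0. Qed.
Let iid_sigma_additive : semi_sigma_additive iid.
Proof.
move=> F; rewrite fspace_measurableE => mF tF mU.
exact: (@measure_semi_sigma_additive _ _ _ (measure_extension cmeas)).
Qed.

HB.instance Definition _ := isMeasure.Build _ _ _ iid iid0 iid_ge0
  iid_sigma_additive.

Lemma iidE n A : lvl n A -> iid A = finlaw eta n A.
Proof.
move=> lA; rewrite /iid /measure_extension measurable_mu_extE.
  exact: premeasE.
by exists n.
Qed.

Let iidT : iid setT = 1.
Proof. by rewrite (@iidE 0%N) ?probability_setT. Qed.

HB.instance Definition _ := Measure_isProbability.Build _ _ _ iid iidT.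

Lemma iid_box n (B : nat -> set Z) : (forall i, measurable (B i)) ->
  iid [set f | forall i, (i < n)%N -> B i (f i)] = \prod_(i < n) eta (B i).
Proof.
move=> mB; rewrite (@iidE n); last first.
  split; last by move=> f g fg Bf i ni; rewrite -fg//; exact: Bf.
  rewrite (_ : mkset _ = \bigcap_(i in `I_n) [set f : W | B i (f i)]).
    apply: bigcap_measurableType => // i _.
    by rewrite -[X in measurable X]setTI; exact: fspace_measurable_proj.
  by apply/seteqP; split => f.
elim: n B mB => [|n IH] B mB.
  rewrite big_ord0 [mkset _](_ : _ = setT) ?probability_setT//.
  by apply/seteqP; split.
rewrite big_ord_recl finlawS.
transitivity (\int[eta]_z ((\1_(B 0%N) z)%:E * \prod_(i < n) eta (B i.+1))).
  apply: eq_integral => z _; rewrite indicE.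
  have [/set_mem Bz|/negP nBz] := boolP (z \in B 0%N).
    rewrite mul1e -(IH (fun i => B i.+1))//; congr (finlaw eta n _).
    apply/seteqP; split => f /= h; first by move=> i ni; exact: (h i.+1).
    by move=> [|i] //=; exact: h.
  rewrite mul0e [ssec _ _](_ : _ = set0) ?measure0//.
  rewrite -subset0 => f /= /(_ 0%N isT) /= h; apply: nBz; exact/mem_set.
rewrite ge0_integralZr//.
- by rewrite integral_indic// setIT.
- exact/measurable_EFinP/measurable_indic.
- by apply: prode_ge0 => *; exact: measure_ge0.
Qed.

End iid.

Definition fbox (I : choiceType) d (T : measurableType d) (s : seq I)
  (B : I -> set T) : set (fspace I T) := [set f | forall i, i \in s -> B i (f i)].

Section fbox_lemmas.
Context (I : choiceType) d (T : measurableType d) (R : realType).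
Local Open Scope ereal_scope.

Lemma measurable_fbox (s : seq I) (B : I -> set T) :
  (forall i, measurable (B i)) -> measurable (fbox s B).
Proof.
move=> mB; elim: s => [|i s IH].
  rewrite (_ : fbox _ _ = setT)//.
  by apply/seteqP; split => // f _ i; rewrite in_nil.
rewrite (_ : fbox _ _ = [set f : fspace I T | B i (f i)] `&` fbox s B).
  apply: measurableI => //.
  by rewrite -[X in measurable X]setTI; exact: fspace_measurable_proj.
apply/seteqP; split => f.
  move=> Bf; split; first by apply: Bf; rewrite mem_head.
  by move=> j js; apply: Bf; rewrite in_cons js orbT.
by move=> [Bi Bs] j; rewrite in_cons => /predU1P[->//|/Bs].
Qed.

Let G : set (set (fspace I T)) := [set A | exists s (B : I -> set T),
  [/\ uniq s, forall i, measurable (B i) & A = fbox s B]].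

Let measurableG : @measurable _ (fspace I T) = <<s G >>.
Proof.
apply/seteqP; split.
  apply: smallest_sub; first exact: smallest_sigma_algebra.
  move=> _ [i [B [mB ->]]]; apply: sub_sigma_algebra.
  exists [:: i], (fun=> B); split=> //.
  apply/seteqP; split => f /=; first by move=> Bf j; rewrite mem_seq1 => /eqP ->.
  by apply; rewrite mem_seq1.
apply: smallest_sub; first exact: sigma_algebra_measurable.
by move=> _ [s [B [_ mB ->]]]; exact: measurable_fbox.
Qed.

Lemma fspace_probability_unique (P Q : probability (fspace I T) R) :
  (forall (s : seq I) (B : I -> set T), uniq s -> (forall i, measurable (B i)) ->
    P (fbox s B) = Q (fbox s B)) ->
  forall A, measurable A -> P A = Q A.
Proof.
move=> PQ A mA; apply: (measure_unique G (fun=> setT)) => //.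
- move=> _ _ [s1 [B1 [_ mB1 ->]]] [s2 [B2 [_ mB2 ->]]].
  exists (undup (s1 ++ s2)), (fun i => (if i \in s1 then B1 i else setT) `&`
    (if i \in s2 then B2 i else setT)); split; first exact: undup_uniq.
    by move=> i; apply: measurableI; case: ifP.
  apply/seteqP; split => f /=.
    by move=> [f1 f2] i _; split; case: ifP => // ?; [exact: f1|exact: f2].
  move=> h; split => i si; have := h i; rewrite mem_undup mem_cat si ?orbT /=;
    by move=> /(_ isT) [].
- move=> _; exists [::], (fun=> setT); split => //.
  by apply/seteqP; split => // f _ i; rewrite in_nil.
- by rewrite bigcup_const.
- by move=> _ [s [B [us mB ->]]]; exact: PQ.
- by move=> _; rewrite /= probability_setT ltry.
Qed.

End fbox_lemmas.

Section product_probability.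
Context d (Z : measurableType d) (R : realType) (eta : probability Z R).
Local Open Scope ereal_scope.

Definition reindex (I : Type) (e : I -> nat) (w : fspace nat Z) : fspace I Z :=
  w \o e.

Lemma measurable_reindex (I : Type) (e : I -> nat) :
  measurable_fun setT (@reindex I e).
Proof. by apply: fspace_measurable_fun => i; exact: fspace_measurable_proj. Qed.

Lemma reindex_iid_fbox (I : choiceType) (e : I -> nat) (s : seq I)
    (B : I -> set Z) : injective e -> uniq s -> (forall i, measurable (B i)) ->
  iid eta (reindex e @^-1` fbox s B) = \prod_(i <- s) eta (B i).
Proof.
move=> inje us mB; case: s us => [|i0 s'] us.
  rewrite big_nil [X in iid _ X](_ : _ = setT) ?probability_setT//.
  by apply/seteqP; split => // f _ i; rewrite in_nil.
move: (i0 :: s') us => {s'} s us.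
pose N := (\max_(i <- s) e i).+1.
pose B' j := if j \in map e s then B (nth i0 s (index j (map e s))) else setT.
have B'e i : i \in s -> B' (e i) = B i.
  by move=> si; rewrite /B' map_f// index_map// nth_index.
have mB' j : measurable (B' j) by rewrite /B'; case: ifP.
have eN i : i \in s -> (e i < N)%N.
  by move=> si; rewrite ltnS; exact: leq_bigmax_seq.
transitivity (iid eta [set f | forall i, (i < N)%N -> B' i (f i)]).
  congr (iid eta _); apply/seteqP; split => f /=.
    move=> h j _; rewrite /B'; case: ifP => // /mapP[i si ->].
    by rewrite index_map// nth_index//; exact: h.
  by move=> h i si /=; rewrite -(B'e _ si); apply: h; exact: eN.
rewrite iid_box// -(big_mkord xpredT (fun j => eta (B' j))).
rewrite (bigID (mem (map e s)))/= [X in _ * X]big1 ?mule1; last first.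
  by move=> j /negbTE h; rewrite /B' h probability_setT.
rewrite -big_filter (perm_big (map e s)).
  by rewrite big_map; apply: eq_big_seq => i si; rewrite B'e.
apply: uniq_perm; first by rewrite filter_uniq// iota_uniq.
  by rewrite map_inj_uniq.
move=> j; rewrite mem_filter mem_index_iota /= andb_idr// => /mapP[i si ->].
exact: eN.
Qed.

(* eta^I for I countable, as the law of a reindexed i.i.d. sequence; it is
   characterized by product_probability_fbox and fspace_probability_unique *)
Definition product_probability (I : countType) : probability (fspace I Z) R :=
  image_prob (iid eta) (@measurable_reindex I pickle).

Lemma product_probability_fbox (I : countType) (s : seq I) (B : I -> set Z) :
  uniq s -> (forall i, measurable (B i)) ->
  product_probability I (fbox s B) = \prod_(i <- s) eta (B i).
Proof. exact: (reindex_iid_fbox (pcan_inj (@pickleK I))). Qed.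

Lemma reindex_iid (I : countType) (e : I -> nat) A : injective e ->
  measurable A -> iid eta (reindex e @^-1` A) = product_probability I A.
Proof.
move=> inje mA.
apply: (fspace_probability_unique (P := image_prob (iid eta) (@measurable_reindex I e))) => //.
move=> s B us mB; rewrite product_probability_fbox//; exact: reindex_iid_fbox.
Qed.

End product_probability.

#[short(type="countGroupType")]
HB.structure Definition CountGroup := {G of Countable G & Group G}.

Definition is_subgroup (G : groupType) (H : set G) :=
  [/\ H 1%g, forall x y, H x -> H y -> H (x * y)%g & forall x, H x -> H x^-1%g].

Record subgroup (G : groupType) := Subgroup {
  subgroup_set :> G -> Prop ;
  subgroup_prop : is_subgroup subgroup_set }.

Section subgroup.
Variable G : groupType.
Implicit Types (H K : subgroup G) (x y g : G).

Lemma subgroup_ext H K : subgroup_set H = subgroup_set K -> H = K.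
Proof.
case: H K => H pH [K pK] /= HK; subst K; congr Subgroup; exact: Prop_irrelevance.
Qed.

Lemma subgroup1 H : H 1%g. Proof. by case: (subgroup_prop H). Qed.
Lemma subgroupM H x y : H x -> H y -> H (x * y)%g.
Proof. by case: (subgroup_prop H) => _ + _; exact. Qed.
Lemma subgroupV H x : H x -> H x^-1%g.
Proof. by case: (subgroup_prop H) => _ _; exact. Qed.

Lemma trivial_is_subgroup : is_subgroup [set 1%g : G].
Proof.
by split => //= [x y -> ->|x ->]; rewrite ?mulg1 ?invg1.
Qed.

HB.instance Definition _ := gen_eqMixin (subgroup G).
HB.instance Definition _ := gen_choiceMixin (subgroup G).
HB.instance Definition _ := isPointed.Build (subgroup G) (Subgroup trivial_is_subgroup).

Lemma conj_is_subgroup g H : is_subgroup [set (g * h * g^-1)%g | h in subgroup_set H].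
Proof.
split=> [|_ _ [x Hx <-] [y Hy <-]|_ [x Hx <-]].
- by exists 1%g; [exact: subgroup1|rewrite mulg1 mulgV].
- by exists (x * y)%g; [exact: subgroupM|rewrite !mulgA mulgVK].
- by exists x^-1%g; [exact: subgroupV|rewrite !invgM invgK mulgA].
Qed.

Definition conj_subgroup g H := Subgroup (conj_is_subgroup g H).

Lemma conj_subgroupE g H x : conj_subgroup g H x = H (g^-1 * x * g)%g.
Proof.
apply/propext; split => [[h Hh <-]|Hx]; first by rewrite !mulgA mulVg mul1g mulgVK.
by exists (g^-1 * x * g)%g => //; rewrite !mulgA mulgV mul1g mulgK.
Qed.

Lemma conj_subgroup1 H : conj_subgroup 1%g H = H.
Proof.
by apply: subgroup_ext; apply/funext => x; rewrite conj_subgroupE invg1 mul1g mulg1.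
Qed.

Lemma conj_subgroupM g h H :
  conj_subgroup (g * h)%g H = conj_subgroup g (conj_subgroup h H).
Proof.
apply: subgroup_ext; apply/funext => x.
by rewrite !conj_subgroupE invgM !mulgA.
Qed.

(* Sub(G) carries the Borel sets of its topology as a subspace of 2^G *)
Definition subgroup_indic H : prod_topology (fun _ : G => bool) :=
  fun g => `[< H g >].
Definition subgroup_open : set (set (subgroup G)) :=
  [set subgroup_indic @^-1` V | V in open].

End subgroup.

Section subgroup_measurable.
Variable G : groupType.
Let O : set (set (subgroup G)) := @subgroup_open G.

HB.instance Definition _ := @isMeasurable.Build default_measure_display
  (subgroup G) <<s O >> (@sigma_algebra0 _ setT O) (@sigma_algebraC _ O)
  (@sigma_algebra_bigcup _ setT O).

Lemma measurable_subgroup_mem (g : G) : measurable [set H : subgroup G | H g].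
Proof.
apply: sub_sigma_algebra.
exists ((fun f : prod_topology (fun _ : G => bool) => f g) @^-1` [set true]).
  apply: open_comp; last exact: discrete_open.
  by move=> f _; exact: proj_continuous.
by apply/seteqP; split => H /=; rewrite /subgroup_indic => /asboolP.
Qed.
End subgroup_measurable.

Section subgroup_generators.
Variable G : countGroupType.

Lemma subgroup_measurableE : @measurable _ (subgroup G) =
  <<s range (fun (g : G) => [set H : subgroup G | H g]) >>.
Proof.
apply/seteqP; split; last first.
  apply: smallest_sub; first exact: sigma_algebra_measurable.
  by move=> _ [g _ <-]; exact: measurable_subgroup_mem.
pose S := range (fun (g : G) => [set H : subgroup G | H g]); pose X := g_sigma_algebraType S. rewrite -/S.
apply: smallest_sub; first exact: smallest_sigma_algebra.
move=> _ [V oV <-].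
pose cyl (p : seq bool) : set (subgroup G) := [set H | forall x : G,
  (pickle x < size p)%N -> subgroup_indic H x = nth false p (pickle x)].
have mcyl p : @measurable _ X (cyl p).
  rewrite (_ : cyl p = \bigcap_(x in [set: G]) [set H : subgroup G |
     (pickle x < size p)%N -> subgroup_indic H x = nth false p (pickle x)]); last first.
    by apply/seteqP; split => H h x; [move=> _; exact: h|exact: (h x I)].
  have mB x : @measurable _ X [set H : subgroup G |
     (pickle x < size p)%N -> subgroup_indic H x = nth false p (pickle x)].
    have [px|px] := boolP (pickle x < size p)%N; last first.
      rewrite (_ : mkset _ = setT)//.
      by apply/seteqP; split.
    have mx : @measurable _ X [set H : subgroup G | H x].
      by apply: sub_sigma_algebra; exists x.
    case: (nth false p (pickle x)).
      rewrite (_ : mkset _ = [set H : subgroup G | H x])//.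
      apply/seteqP; split => H /=; rewrite /subgroup_indic.
        by move=> /(_ isT) /asboolP.
      by move=> Hx _; exact/asboolP.
    rewrite (_ : mkset _ = ~` [set H : subgroup G | H x]); first exact: measurableC.
    apply/seteqP; split => H /=; rewrite /subgroup_indic.
      by move=> /(_ isT) /asboolPn.
    by move=> Hx _; exact/asboolPn.
  rewrite -(setCK (\bigcap_(x in _) _)) setC_bigcap; apply: measurableC.
  by apply: countable_bigcupT_measurable => // x; exact: measurableC.
pose F (p : seq bool) := if pselect (cyl p `<=` @subgroup_indic G @^-1` V)
  is left _ then cyl p else set0.
rewrite (_ : _ @^-1` V = \bigcup_(p in setT) F p).
  apply: (@countable_bigcupT_measurable _ X) => // p.
  by rewrite /F; case: pselect.
apply/seteqP; split => [H VH|H [p _]]; last by rewrite /F; case: pselect => // + Hp; exact.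
have [n hn] : exists n, forall f : prod_topology (fun _ : G => bool),
    (forall x, (pickle x < n)%N -> f x = subgroup_indic H x) -> V f.
  apply: contrapT => /forallNP h.
  have {}h n : exists f : prod_topology (fun _ : G => bool),
     (forall x, (pickle x < n)%N -> f x = subgroup_indic H x) /\ ~ V f.
    by have /existsNP[f /not_implyP hf] := h n; exists f.
  have [f hf] := @choice _ _ _ h.
  have fH : f @ \oo --> (subgroup_indic H : prod_topology (fun _ : G => bool)).
    apply/cvg_sup => x; apply/cvg_image.
      by apply/seteqP; split => // b _; exists (fun=> b).
    apply: (@cvg_trans _ ((fun n => f n x) @ \oo)).
      move=> W [N _ hW]; exists [set g | W (g x)]; first by exists N.
      apply/seteqP; split => b /=; first by move=> [g + <-].
      by move=> Wb; exists (fun=> b).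
    apply: cvg_near_cst; exists (pickle x).+1 => // n /= xn.
    exact: (hf n).1.
  have [N _ /(_ N (leqnn _))] := fH _ (open_nbhs_nbhs (conj oV VH)).
  exact: (hf N).2.
pose p := [seq (if @unpickle G i is Some x then subgroup_indic H x else false)
   | i <- iota 0 n].
have np x : (pickle x < n)%N -> nth false p (pickle x) = subgroup_indic H x.
  by move=> xn; rewrite (nth_map 0%N) ?size_iota// nth_iota// add0n pickleK.
have sp : size p = n by rewrite size_map size_iota.
exists p => //; rewrite /F; case: pselect => [_ x|[]].
  by rewrite sp => /np.
by move=> K; rewrite /cyl /= sp => hK; apply: hn => x xn; rewrite hK// np.
Qed.

Lemma subgroup_measurable_fun d (X : measurableType d) (f : X -> subgroup G) :
  (forall g, measurable [set x | f x g]) -> measurable_fun setT f.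
Proof.
move=> mf; apply: (measurability (range (fun (g : G) => [set H : subgroup G | H g]))).
  exact: subgroup_measurableE.
by move=> _ [_ [g _ <-] <-]; rewrite setTI; exact: mf.
Qed.

Lemma measurable_conj_subgroup (g : G) : measurable_fun setT (conj_subgroup g).
Proof.
apply: subgroup_measurable_fun => x.
rewrite (_ : mkset _ = [set H : subgroup G | H (g^-1 * x * g)%g]).
  exact: measurable_subgroup_mem.
by apply/funext => H; rewrite /mkset conj_subgroupE.
Qed.

End subgroup_generators.

Definition right_coset (G : groupType) (H : subgroup G) (g : G) : set G :=
  [set (h * g)%g | h in subgroup_set H].

(* H \ G *)
Definition coset (G : groupType) (H : subgroup G) : Type :=
  {C : set G | exists g, C = right_coset H g}.

Section coset.
Variables (G : groupType) (H : subgroup G).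
Implicit Types (C D : coset H) (g x y : G).

Definition mkcoset g : coset H := exist _ (right_coset H g) (ex_intro _ g erefl).

Lemma right_cosetE g x : right_coset H g x = H (x * g^-1)%g.
Proof.
apply/propext; split => [[h Hh <-]|Hx]; first by rewrite mulgK.
by exists (x * g^-1)%g => //; rewrite mulgVK.
Qed.

Lemma coset_ext C D : sval C = sval D -> C = D.
Proof.
case: C D => C pC [D pD] /= CD; subst D; congr exist; exact: Prop_irrelevance.
Qed.

Lemma mkcoset_eq g g' : H (g * g'^-1)%g -> mkcoset g = mkcoset g'.
Proof.
move=> Hgg; apply: coset_ext; apply/funext => x /=; rewrite !right_cosetE.
apply/propext; split => Hx.
  by have := subgroupM Hx Hgg; rewrite mulgA mulgVK.
by have := subgroupM Hx (subgroupV Hgg); rewrite invgM invgK mulgA mulgVK.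
Qed.

Lemma mem_mkcoset g : right_coset H g g.
Proof. by rewrite right_cosetE mulgV; exact: subgroup1. Qed.

Lemma coset_mem C g : sval C g -> C = mkcoset g.
Proof.
have [g' Eg] := svalP C; rewrite [X in X g]Eg right_cosetE => Hg.
by rewrite (mkcoset_eq Hg); exact: coset_ext.
Qed.

Lemma coset_nonempty C : exists g, sval C g.
Proof. by have [g Eg] := svalP C; exists g; rewrite Eg; exact: mem_mkcoset. Qed.

Definition coset_repr C : G := projT1 (cid (coset_nonempty C)).

Lemma coset_reprK : cancel coset_repr mkcoset.
Proof. by move=> C; rewrite /coset_repr; case: cid => g /= /coset_mem ->. Qed.

End coset.

HB.instance Definition _ (G : countGroupType) (H : subgroup G) :=
  Countable.copy (coset H) (can_type (@coset_reprK G H)).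

(* Z^(<= \ G), the disjoint union over H of Z^(H \ G) *)
Definition coset_fspace (G : groupType) (Z : Type) :=
  {H : subgroup G & fspace (coset H) Z}.

Section coset_fspace_pointed.
Variables (G : groupType) (Z : pointedType).
HB.instance Definition _ := gen_eqMixin (coset_fspace G Z).
HB.instance Definition _ := gen_choiceMixin (coset_fspace G Z).
HB.instance Definition _ := isPointed.Build (coset_fspace G Z)
  (existT _ point (fun=> point)).
End coset_fspace_pointed.

(* H_f *)
Definition base (G : groupType) (Z : Type) (f : coset_fspace G Z) : subgroup G :=
  projT1 f.

(* f |-> ((g |-> f (H_f g)), H_f), which induces the Borel structure *)
Definition coset_fspace_inj (G : groupType) (Z : Type) (f : coset_fspace G Z) :
    fspace G Z * subgroup G :=
  ((fun g => projT2 f (mkcoset (base f) g)), base f).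

HB.instance Definition _ (G : groupType) d (Z : measurableType d) :=
  Measurable.copy (coset_fspace G Z)
    (g_sigma_algebra_preimageType
      (@coset_fspace_inj G Z : coset_fspace G Z -> fspace G Z * subgroup G)).

Section shift.
Variables (G : groupType) (Z : Type).
Implicit Types (f : coset_fspace G Z) (g d : G).

Lemma coset_fspace_injP : injective (@coset_fspace_inj G Z).
Proof.
move=> [H f] [K h]; rewrite /coset_fspace_inj /base /= => -[fh HK]; subst K.
congr existT; apply/funext => C; rewrite -(coset_reprK C).
exact: (congr1 (@^~ (coset_repr C)) fh).
Qed.

Lemma translate_coset_subproof g (H : subgroup G) (C : coset (conj_subgroup g H)) :
  exists d, [set (g^-1 * x)%g | x in sval C] = right_coset H d.
Proof.
have [d Cd] := coset_nonempty C; rewrite (coset_mem Cd); exists (g^-1 * d)%g.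
apply/funext => x; rewrite right_cosetE; apply/propext; split.
  move=> [y] /=; rewrite right_cosetE conj_subgroupE => Hy <-.
  by move: Hy; rewrite invgM invgK !mulgA.
move=> Hx; exists (g * x)%g; last by rewrite mulKg.
rewrite /= right_cosetE conj_subgroupE; move: Hx.
by rewrite invgM invgK !mulgA mulVg mul1g.
Qed.

(* the bijection C |-> g^-1 C from (g H g^-1) \ G onto H \ G *)
Definition translate_coset g (H : subgroup G) (C : coset (conj_subgroup g H)) :
    coset H :=
  exist _ [set (g^-1 * x)%g | x in sval C] (translate_coset_subproof C).

Lemma translate_mkcoset g (H : subgroup G) d :
  translate_coset (mkcoset (conj_subgroup g H) d) = mkcoset H (g^-1 * d)%g.
Proof. by apply: coset_mem; exists d => //; exact: mem_mkcoset. Qed.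

Lemma translate_coset_inj g (H : subgroup G) : injective (@translate_coset g H).
Proof.
move=> C D CD; have [d Cd] := coset_nonempty C.
have : sval (translate_coset C) (g^-1 * d)%g by exists d.
rewrite CD => -[d' Dd' /mulgI dd']; rewrite -dd' in Cd.
by rewrite (coset_mem Cd) (coset_mem Dd').
Qed.

(* the action s, (g^s f)(g H_f g^-1 d) = f (H_f g^-1 d) *)
Definition shift g f : coset_fspace G Z :=
  existT _ (conj_subgroup g (base f)) (fun C => projT2 f (translate_coset C)).

Lemma shiftE g f d :
  projT2 (shift g f) (mkcoset (conj_subgroup g (base f)) d) =
  projT2 f (mkcoset (base f) (g^-1 * d)%g).
Proof. by rewrite /= translate_mkcoset. Qed.

Lemma coset_fspace_inj_shift g f : coset_fspace_inj (shift g f) =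
  ((fun d => (coset_fspace_inj f).1 (g^-1 * d)%g), conj_subgroup g (base f)).
Proof.
rewrite /coset_fspace_inj; congr pair; apply/funext => d /=.
by rewrite translate_mkcoset.
Qed.

Lemma shift1 f : shift 1%g f = f.
Proof.
apply: coset_fspace_injP; rewrite coset_fspace_inj_shift conj_subgroup1.
rewrite [RHS]surjective_pairing; congr pair; apply/funext => d.
by rewrite invg1 mul1g.
Qed.

Lemma shiftM g h f : shift (g * h)%g f = shift g (shift h f).
Proof.
apply: coset_fspace_injP; rewrite !coset_fspace_inj_shift /= conj_subgroupM.
by congr pair; apply/funext => d /=; rewrite ?translate_mkcoset invgM mulgA.
Qed.

End shift.

Section coset_fspace_measurable.
Context (G : countGroupType) d (Z : measurableType d).
Local Notation X := (coset_fspace G Z).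

Lemma measurable_coset_fspace_inj :
  measurable_fun setT (@coset_fspace_inj G Z : X -> fspace G Z * subgroup G).
Proof. by move=> _ A mA; rewrite setTI; exists A => //; rewrite setTI. Qed.

Lemma coset_fspace_measurable_fun d' (T : measurableType d') (f : T -> X) :
  (forall g, measurable_fun setT (fun t => projT2 (f t) (mkcoset (base (f t)) g))) ->
  measurable_fun setT (fun t => base (f t)) -> measurable_fun setT f.
Proof.
move=> m1 m2 _ A [B mB <-]; rewrite !setTI -comp_preimage -[X in measurable X]setTI.
have : measurable_fun setT (@coset_fspace_inj G Z \o f); last by apply.
by apply: measurable_fun_pair => //; exact: fspace_measurable_fun.
Qed.

Lemma measurable_base : measurable_fun setT (@base G Z : X -> _).
Proof. exact: (measurableT_comp measurable_snd measurable_coset_fspace_inj). Qed.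

Lemma measurable_coset_eval (g : G) :
  measurable_fun setT (fun f : X => projT2 f (mkcoset (base f) g)).
Proof.
have := measurableT_comp measurable_fst measurable_coset_fspace_inj.
exact: (measurableT_comp (@fspace_measurable_proj _ _ _ g)).
Qed.

Lemma measurable_shift (g : G) : measurable_fun setT (@shift G Z g : X -> X).
Proof.
apply: coset_fspace_measurable_fun => [d'|].
  rewrite (_ : (fun f => _) = fun f : X => projT2 f (mkcoset (base f) (g^-1 * d')%g)).
    exact: measurable_coset_eval.
  by apply/funext => f; rewrite shiftE.
exact: (measurableT_comp (measurable_conj_subgroup g) measurable_base).
Qed.

Lemma measurable_inclusion (H : subgroup G) :
  measurable_fun setT (existT _ H : fspace (coset H) Z -> X).
Proof.
apply: coset_fspace_measurable_fun => [g|]; last exact: measurable_cst.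
exact: (@fspace_measurable_proj _ _ Z (mkcoset H g)).
Qed.

End coset_fspace_measurable.

Section coset_index.
Variable G : countGroupType.

Lemma coset_index_subproof (H : subgroup G) (C : coset H) :
  exists n, `[< exists g : G, sval C g /\ pickle g = n >].
Proof. by have [g Cg] := coset_nonempty C; exists (pickle g); apply/asboolP; exists g. Qed.

(* Unlike pickle on coset H, this enumeration depends measurably on H. *)
Definition coset_index (H : subgroup G) (C : coset H) : nat :=
  ex_minn (coset_index_subproof C).

Lemma coset_index_inj (H : subgroup G) : injective (@coset_index H).
Proof.
move=> C D; rewrite /coset_index.
case: ex_minnP => _ /asboolP[g [Cg <-]] _.
case: ex_minnP => _ /asboolP[h [Dh <-]] _ /(pcan_inj (@pickleK G)) gh.
by rewrite (coset_mem Cg) (coset_mem Dh) gh.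
Qed.

Lemma measurable_coset_index (g : G) :
  measurable_fun setT (fun H : subgroup G => coset_index (mkcoset H g)).
Proof.
have mE n : measurable [set H : subgroup G |
    exists x : G, sval (mkcoset H g) x /\ pickle x = n].
  case: (unpickle n =P None :> option G) => [nN|].
    rewrite (_ : mkset _ = set0)// -subset0 => H [x [_ xn]].
    by move: nN; rewrite -xn pickleK.
  have [[x xn] _|nx _] := pselect (exists x : G, pickle x = n); last first.
    rewrite (_ : mkset _ = set0)// -subset0 => H [x [_ xn]].
    by apply: nx; exists x.
  rewrite (_ : mkset _ = [set H : subgroup G | H (x * g^-1)%g]).
    exact: measurable_subgroup_mem.
  apply/seteqP; split => H /=.
    move=> [y [+ yn]]; rewrite right_cosetE.
    by have -> : y = x by apply: (pcan_inj (@pickleK G)); rewrite xn yn.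
  by move=> Hx; exists x; rewrite right_cosetE.
move=> _ B _; rewrite setTI.
rewrite (_ : _ @^-1` B = \bigcup_(n in B) ([set H : subgroup G |
    exists x : G, sval (mkcoset H g) x /\ pickle x = n] `\`
    \bigcup_(m in `I_n) [set H : subgroup G |
    exists x : G, sval (mkcoset H g) x /\ pickle x = m])).
  apply: bigcup_measurable => n _; apply: measurableD => //.
  by apply: bigcup_measurable => m _.
apply/seteqP; split => H /=.
  rewrite /coset_index; case: ex_minnP => n /asboolP hn nmin Bn.
  exists n => //; split => // -[m /= mn hm].
  by move: mn; rewrite ltnNge nmin//; exact/asboolP.
move=> [n Bn [hn nmin]]; rewrite /coset_index; case: ex_minnP => m /asboolP hm mmin.
suff -> : m = n by [].
apply/eqP; rewrite eqn_leq mmin; last exact/asboolP.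
by rewrite leqNgt; apply/negP => mn; apply: nmin; exists m.
Qed.

End coset_index.

Section mixture.
Context d d' (X : measurableType d) (T : measurableType d') (R : realType).
Local Open Scope ereal_scope.
Variables (mu : probability X R) (k : X -> probability T R).
Hypothesis mk : forall A, measurable A -> measurable_fun [set: X] (fun x => k x A).

(* int k_x dmu(x) *)
Definition mixture of (forall A, measurable A ->
    measurable_fun [set: X] (fun x => k x A)) : set T -> \bar R :=
  fun A => \int[mu]_x k x A.

Let mixture0 : mixture mk set0 = 0.
Proof. by rewrite /mixture integral0_eq// => x _; exact: measure0. Qed.

Let mixture_ge0 A : 0 <= mixture mk A.
Proof. by apply: integral_ge0 => x _; exact: measure_ge0. Qed.

Let mixture_sigma_additive : semi_sigma_additive (mixture mk).
Proof.
move=> F mF tF mUF; rewrite [X in _ --> X](_ : _ =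
    \sum_(n <oo) mixture mk (F n)).
  by apply/cvg_closeP; split; [exact: is_cvg_nneseries|rewrite closeE].
rewrite -integral_nneseries//; last by move=> n; exact: mk.
by apply: eq_integral => x _; exact: measure_semi_bigcup.
Qed.

HB.instance Definition _ := isMeasure.Build _ _ _ (mixture mk)
  mixture0 mixture_ge0 mixture_sigma_additive.

Let mixtureT : mixture mk setT = 1.
Proof.
rewrite /mixture (eq_integral (cst 1)); last first.
  by move=> x _; exact: probability_setT.
by rewrite integral_cst//= probability_setT mule1.
Qed.

HB.instance Definition _ := Measure_isProbability.Build _ _ _ (mixture mk) mixtureT.

End mixture.

Section bernoulli_at.
Context (G : countGroupType) d (Z : measurableType d) (R : realType)
  (eta : probability Z R).
Local Notation X := (coset_fspace G Z).

(* eta^(H \ G), as a measure on Z^(<= \ G) *)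
Definition bernoulli_at (H : subgroup G) : probability X R :=
  image_prob (product_probability eta (coset H)) (@measurable_inclusion G d Z H).

Lemma bernoulli_atE H A : measurable A -> bernoulli_at H A =
  iid eta [set w | A (existT _ H (reindex (@coset_index G H) w) : X)].
Proof.
move=> mA; apply/esym/(@reindex_iid _ Z R eta (coset H) (@coset_index G H)
  (existT _ H @^-1` A)); first exact: coset_index_inj.
by rewrite -[X in measurable X]setTI; exact: measurable_inclusion.
Qed.

Lemma measurable_index_map d' (T : measurableType d') (K : T -> subgroup G) :
  measurable_fun setT K -> measurable_fun setT (fun tw : T * fspace nat Z =>
    existT _ (K tw.1) (reindex (@coset_index G (K tw.1)) tw.2) : X).
Proof.
move=> mK; apply: coset_fspace_measurable_fun => [g|]; last first.
  exact: (measurableT_comp mK measurable_fst).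
move=> _ B mB; rewrite setTI.
pose c (t : T) := coset_index (mkcoset (K t) g).
have mc : measurable_fun setT c.
  exact: (measurableT_comp (measurable_coset_index g) mK).
rewrite (_ : _ @^-1` B = \bigcup_n ((c \o fst) @^-1` [set n] `&`
    [set tw : T * fspace nat Z | B (tw.2 n)])).
  apply: bigcupT_measurable => n; apply: measurableI.
    rewrite -[X in measurable X]setTI.
    by apply: (measurableT_comp mc measurable_fst).
  rewrite -[X in measurable X]setTI.
  exact: (measurableT_comp (@fspace_measurable_proj nat _ Z n) measurable_snd).
apply/seteqP; split => -[t w] /=; first by move=> Bw; exists (c t).
by move=> [n _ [/= <-]].
Qed.

Lemma measurable_bernoulli_at_section d' (T : measurableType d')
    (K : T -> subgroup G) (A : set (X * T)) : measurable_fun setT K ->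
  measurable A -> measurable_fun [set: T] (fun t => bernoulli_at (K t) (ysection A t)).
Proof.
move=> mK mA.
pose Psi (tw : T * fspace nat Z) : X * T :=
  (existT _ (K tw.1) (reindex (@coset_index G (K tw.1)) tw.2), tw.1).
have mPsi : measurable_fun setT Psi.
  by apply: measurable_fun_pair => //; exact: measurable_index_map.
rewrite (_ : (fun t => _) = iid eta \o xsection (Psi @^-1` A)).
  apply: measurable_fun_xsection.
  by rewrite -[X in measurable X]setTI; exact: mPsi.
apply/funext => t; rewrite bernoulli_atE; last exact: measurable_ysection.
rewrite /comp; congr (iid eta _).

Qed.

Lemma measurable_bernoulli_at A : measurable A ->
  measurable_fun [set: subgroup G] (fun H => bernoulli_at H A).
Proof.
move=> mA; rewrite (_ : (fun H => _) =
    fun H => bernoulli_at H (ysection (A `*` [set: subgroup G]) H)).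
  by apply: measurable_bernoulli_at_section => //; exact: measurableX.
apply/funext => H; congr (bernoulli_at H _); apply/seteqP.
by split => f; rewrite /ysection /= inE => // -[].
Qed.

Lemma bernoulli_at_conj g H A : measurable A ->
  bernoulli_at (conj_subgroup g H) A = bernoulli_at H (shift g @^-1` A).
Proof.
move=> mA.
have mB : measurable (existT _ (conj_subgroup g H) @^-1` A :
    set (fspace (coset (conj_subgroup g H)) Z)).
  by rewrite -[X in measurable X]setTI; exact: measurable_inclusion.
rewrite [LHS](_ : _ = product_probability eta (coset (conj_subgroup g H))
   (existT _ (conj_subgroup g H) @^-1` A))//.
rewrite -(@reindex_iid _ Z R eta _ (pickle \o @translate_coset _ g H))//.
apply: inj_comp; last exact: translate_coset_inj.
exact: (pcan_inj (@pickleK _)).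
Qed.

End bernoulli_at.

(* T is Borel isomorphic to a separable complete metric space *)
Definition standard_borel (R : realType) d (T : measurableType d) : Prop :=
  exists (X : metricType R) (f : T -> X),
    [/\ exists2 D : set X, countable D & dense D,
        forall F : set_system X, ProperFilter F -> cauchy F -> exists x : X, F --> x,
        bijective f &
        @measurable _ T = [set f @^-1` B | B in <<s open >>]].

Definition non_atomic (R : realType) d (T : measurableType d)
    (mu : {measure set T -> \bar R}) : Prop :=
  forall A, measurable A -> (0 < mu A)%E ->
    exists B, [/\ measurable B, B `<=` A, (0 < mu B)%E & (mu B < mu A)%E].

(* The underlying space is an arbitrary measurable space: that it is standard
   Borel is a separate hypothesis. As G is discrete and countable, the action is
   Borel as soon as every group element acts by a measurable map. *)
Record mp_action (R : realType) (G : groupType) d (Y : measurableType d) := MpAction {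
  act :> G -> Y -> Y ;
  mp_measure : probability Y R ;
  act1 : forall y, act 1%g y = y ;
  actM : forall g h y, act (g * h)%g y = act g (act h y) ;
  measurable_act : forall g, measurable_fun setT (act g) ;
  act_preserving : forall g A, measurable A ->
    mp_measure (act g @^-1` A) = mp_measure A }.

Record IRS (R : realType) (G : groupType) := MkIRS {
  irs_measure :> probability (subgroup G) R ;
  irs_invariant : forall g A, measurable A ->
    irs_measure (conj_subgroup g @^-1` A) = irs_measure A }.

Section random_bernoulli_shift.
Context (R : realType) (G : countGroupType) d (Z : measurableType d).
Variables (theta : IRS R G) (eta : probability Z R).

(* eta^(theta \ G) *)
Definition random_bernoulli_measure : probability (coset_fspace G Z) R :=
  mixture theta (measurable_bernoulli_at eta).

Lemma random_bernoulli_measureE A :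
  random_bernoulli_measure A = (\int[theta]_H bernoulli_at eta H A)%E.
Proof. by []. Qed.

Lemma random_bernoulli_invariant g (A : set (coset_fspace G Z)) : measurable A ->
  random_bernoulli_measure (shift g @^-1` A) = random_bernoulli_measure A.
Proof.
move=> mA; rewrite !random_bernoulli_measureE.
under eq_integral do rewrite -bernoulli_at_conj//.
have mc := measurable_conj_subgroup g.
rewrite -(@ge0_integral_pushforward _ _ _ _ _ _ mc theta setT
  (fun H => bernoulli_at eta H A))//; last exact: measurable_bernoulli_at.
apply: eq_measure_integral => B mB _; exact: irs_invariant.
Qed.

Definition random_bernoulli_shift : mp_action R G (coset_fspace G Z) :=
  MpAction (@shift1 G Z) (@shiftM G Z) (@measurable_shift G d Z)
    random_bernoulli_invariant.

End random_bernoulli_shift.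

Section stabilizer.
Context (R : realType) (G : countGroupType) d (Y : measurableType d).
Variable a : mp_action R G Y.

Lemma stabilizer_is_subgroup y : is_subgroup [set g | a g y = y].
Proof.
split => /= [|g h ga ha|g ga]; first exact: act1.
  by rewrite actM ha.
by rewrite -[in LHS]ga -actM mulVg act1.
Qed.

Definition stabilizer y : subgroup G := Subgroup (stabilizer_is_subgroup y).

Lemma stabilizer_act g y : stabilizer (a g y) = conj_subgroup g (stabilizer y).
Proof.
apply: subgroup_ext; apply/funext => x; rewrite conj_subgroupE /=.
apply/propext; split => [h|h].
  by rewrite !actM h -actM mulVg act1.
by rewrite -[in RHS]h -!actM !mulgA mulgV mul1g.
Qed.

Hypothesis sY : standard_borel R Y.

Lemma measurable_fixpoints (f : Y -> Y) : measurable_fun setT f ->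
  measurable [set y | f y = y].
Proof.
move: sY => [X [phi [[D cD dD] _ bphi mE]]] mf.
have oB (x : X) (r : R) : open [set y | mdist x y < r].
  rewrite openE => y /= xyr; apply/nbhs_ballP; exists (r - mdist x y) => /=.
    by rewrite subr_gt0.
  rewrite ballEmdist => z /=; rewrite ltrBrDl => h.
  exact: le_lt_trans (metric_triangle _ _ _) h.
have mB (x : X) (r : R) : measurable [set y | mdist x (phi y) < r].
  rewrite mE; exists [set y | mdist x y < r] => //.
  by apply: sub_sigma_algebra; exact: oB.
pose E n x := [set y | mdist x (phi y) < n.+1%:R^-1] `\`
  (f @^-1` [set y | mdist x (phi y) < n.+1%:R^-1]).
have mEn n x : measurable (E n x).
  by apply: measurableD => //; rewrite -[X in measurable X]setTI; exact: mf.
have mU n : measurable (\bigcup_(x in D) E n x).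
  rewrite (_ : \bigcup_(x in D) E n x = \bigcup_(x in [set: {x | D x}]) E n (sval x)).
    apply: countable_bigcupT_measurable => //.
    have /countable_injP[h hinj] := cD.
    apply/countable_injP; exists (fun x : {x | D x} => h (sval x)).
    move=> [x Dx] [y Dy] _ _ /= hxy.
    have xy : x = y by apply: hinj => //; exact/mem_set.
    by subst y; congr exist; exact: Prop_irrelevance.
  apply/seteqP; split => y; first by move=> [x Dx Exy]; exists (exist _ x Dx).
  by move=> [[x Dx] _ Exy]; exists x.
rewrite -(setCK [set y | f y = y]); apply: measurableC.
rewrite (_ : ~` _ = \bigcup_n \bigcup_(x in D) E n x).
  exact: bigcupT_measurable.
apply/seteqP; split => y /=; last first.
  by move=> [n _ [x _ [/= h1 h2]]] fy; apply: h2; rewrite /= fy.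
move=> fy; have d0 : 0 < mdist (phi y) (phi (f y)).
  by rewrite mdist_gt0; apply/eqP => h; apply: fy; rewrite -(bij_inj bphi h).
have [n hn] : exists n, n.+1%:R^-1 < mdist (phi y) (phi (f y)) / 2.
  have h0 : 0 < mdist (phi y) (phi (f y)) / 2 by rewrite divr_gt0.
  by have [n] := ltr_add_invr h0; rewrite add0r; exists n.
have [x [/= yx Dx]] : [set z | mdist (phi y) z < n.+1%:R^-1] `&` D !=set0.
  apply: dD; last exact: oB.
  by exists (phi y); rewrite /= mdistxx invr_gt0.
have sym : mdist x (phi y) < n.+1%:R^-1.
  have := @ball_sym _ _ (phi y) x n.+1%:R^-1.
  by rewrite !ballEmdist /=; exact.
exists n => //; exists x => //; split => //= h.
have := le_lt_trans (metric_triangle (phi y) x (phi (f y))) (ltrD yx h).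
by rewrite ltNge => /negP; apply; rewrite [leRHS]splitr ltW// ltrD.
Qed.

Lemma measurable_stabilizer : measurable_fun setT stabilizer.
Proof.
apply: subgroup_measurable_fun => g; exact: (measurable_fixpoints (measurable_act a g)).
Qed.

Let stab_measure : probability (subgroup G) R :=
  image_prob (mp_measure a) measurable_stabilizer.

Let stab_invariant g A : measurable A ->
  stab_measure (conj_subgroup g @^-1` A) = stab_measure A.
Proof.
move=> mA; rewrite /stab_measure /= /image_prob /pushforward.
rewrite -[RHS](@act_preserving _ _ _ _ a g); last first.
  by rewrite -[X in measurable X]setTI; exact: measurable_stabilizer.
congr (mp_measure a _); apply/seteqP.
by split => y; rewrite /= stabilizer_act.
Qed.

(* type(a), the image of the measure of a under y |-> stabilizer y *)
Definition mp_type : IRS R G := MkIRS stab_invariant.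

Context dZ (Z : measurableType dZ) (eta : probability Z R).
Local Notation X := (coset_fspace G Z).
Local Open Scope ereal_scope.

Lemma prod_diracE (m : probability X R) (y : Y) A : measurable A ->
  (m \x \d_y) A = m (ysection A y).
Proof.
move=> mA; have mAy := measurable_ysection y mA.
transitivity (\int[m]_f (\1_(ysection A y) f)%:E).
  apply: eq_integral => f _; rewrite /= diracE indicE.
  suff -> : (y \in xsection A f) = (f \in ysection A y) by [].
  by rewrite mem_xsection mem_ysection.
by rewrite integral_indic// setIT.
Qed.

(* eta^(G_y \ G) x delta_y, where G_y is the stabilizer of y *)
Definition joining_at (y : Y) : probability (X * Y)%type R :=
  bernoulli_at eta (stabilizer y) \x \d_y.

Lemma measurable_joining_at A : measurable A ->
  measurable_fun [set: Y] (fun y => joining_at y A).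
Proof.
move=> mA; rewrite (_ : (fun y => _) =
    fun y => bernoulli_at eta (stabilizer y) (ysection A y)).
  exact: measurable_bernoulli_at_section measurable_stabilizer _.
by apply/funext => y; exact: prod_diracE.
Qed.

Definition joining_measure : probability (X * Y)%type R :=
  mixture (mp_measure a) measurable_joining_at.

Lemma joining_measureE A : joining_measure A =
  \int[mp_measure a]_y (bernoulli_at eta (stabilizer y) \x \d_y) A.
Proof. by []. Qed.

Definition joining_act (g : G) (fy : (X * Y)%type) : (X * Y)%type := (shift g fy.1, a g fy.2).

Lemma joining_act1 fy : joining_act 1%g fy = fy.
Proof. by case: fy => f y; rewrite /joining_act /= shift1 act1. Qed.

Lemma joining_actM g h fy :
  joining_act (g * h)%g fy = joining_act g (joining_act h fy).
Proof. by rewrite /joining_act /= shiftM actM. Qed.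

Lemma measurable_joining_act g : measurable_fun setT (joining_act g).
Proof.
apply: measurable_fun_pair.
  exact: (measurableT_comp (measurable_shift g) measurable_fst).
exact: (measurableT_comp (measurable_act a g) measurable_snd).
Qed.

Lemma joining_invariant g A : measurable A ->
  joining_measure (joining_act g @^-1` A) = joining_measure A.
Proof.
move=> mA; rewrite !joining_measureE.
transitivity (\int[mp_measure a]_y joining_at (a g y) A).
  apply: eq_integral => y _; rewrite /joining_at /=.
  rewrite !prod_diracE//; last first.
    by rewrite -[X in measurable X]setTI; exact: measurable_joining_act.
  have -> : ysection (joining_act g @^-1` A) y = shift g @^-1` ysection A (a g y).
    by apply/seteqP; split => f; rewrite /ysection /= !inE.
  rewrite stabilizer_act.
  exact/esym/(bernoulli_at_conj eta g (stabilizer y) (measurable_ysection (a g y) mA)).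
have ma := measurable_act a g.
rewrite -(@ge0_integral_pushforward _ _ _ _ _ _ ma (mp_measure a) setT
  (fun y => joining_at y A))//; last exact: measurable_joining_at.
by apply: eq_measure_integral => B mB _; exact: act_preserving.
Qed.

(* The joining of the random Bernoulli shift over type(a) with a, over the
   factor maps f |-> H_f and y |-> stabilizer y. *)
Definition relatively_independent_joining : mp_action R G (X * Y)%type :=
  MpAction joining_act1 joining_actM measurable_joining_act joining_invariant.

End stabilizer.

Definition measurable_partition d (T : measurableType d) (k : nat)
    (A : 'I_k -> set T) : Prop :=
  [/\ forall i, measurable (A i), trivIset setT A & \bigcup_i A i = setT].

Section weak_containment.
Context (R : realType) (G : groupType) dX dY (X : measurableType dX)
  (Y : measurableType dY).

Definition weakly_contained (a : mp_action R G X) (b : mp_action R G Y) : Prop :=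
  forall (k : nat) (A : 'I_k -> set X), measurable_partition A ->
  forall (F : seq G) (e : R), 0 < e ->
  exists2 B : 'I_k -> set Y, measurable_partition B &
    forall g, g \in F -> forall i j : 'I_k,
      `| fine (mp_measure a (a g @` A i `&` A j)) -
         fine (mp_measure b (b g @` B i `&` B j)) | < e.

End weak_containment.

Definition weakly_equivalent (R : realType) (G : groupType) dX dY
    (X : measurableType dX) (Y : measurableType dY)
    (a : mp_action R G X) (b : mp_action R G Y) : Prop :=
  weakly_contained a b /\ weakly_contained b a.

(* Main.v *)
Require Import Defs.
From HB Require Import structures.
From mathcomp Require Import all_boot all_order all_algebra.
From mathcomp Require Import all_classical all_reals all_analysis.
From mathcomp Require Import measurable_realfun.
From mathcomp Require Import ring lra.

(** Any labelling p : Y -> nat and any sequence z in Z^nat give an equivariant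
    map Phi_z from Y to the joining, y |-> (G_y d |-> z (p (d^-1 y)), y).  Let z
    be random, with i.i.d. coordinates of law eta, and let C be a set depending
    on y and on finitely many cosets only.  If p separates the relevant points
    of the orbit of y, then Phi_z(y) lies in C with the probability prescribed
    by the joining; if it also separates those of y from those of y', the events
    for y and y' are independent.  As nu is non-atomic, orbits are null, so fine
    labellings do this for all pairs (y, y') outside a set of small nu x nu
    measure.  Hence nu (Phi_z^-1 C) has mean close to the joining measure of C
    and small variance, and some z works for any finite family of sets C.  Pulling
    back by Phi_z a partition into such sets gives the weak containment of the
    joining in a.  The other containments come from factor maps. *)

Set Implicit Arguments.
Unset Strict Implicit.
Import Order.TTheory GRing.Theory Num.Theory.
Import numFieldNormedType.Exports.

Local Open Scope classical_set_scope.
Local Open Scope ring_scope.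

(** * Approximation in probability spaces *)

Section approximation.
Context d (T : measurableType d) (R : realType) (P : probability T R).
Implicit Types (A B C E : set T).

Lemma fine_probability A : measurable A -> (fine (P A))%:E = P A.
Proof. by move=> mA; rewrite fineK// fin_num_measure. Qed.

Lemma probability_agree_off A B E :
  measurable A -> measurable B -> measurable E ->
  (forall x, ~ E x -> A x <-> B x) ->
  `|fine (P A) - fine (P B)| <= fine (P E).
Proof.
move=> mA mB mE AB.
have half C D : measurable C -> measurable D -> C `<=` D `|` E ->
    fine (P C) - fine (P D) <= fine (P E).
  move=> mC mD CDE; rewrite lerBlDl -lee_fin EFinD !fine_probability//.
  apply: (@le_trans _ _ (P (D `|` E))); last exact: measureU2.
  by apply: le_measure => //; rewrite inE//; exact: measurableU.
rewrite ler_norml lerNl opprB; apply/andP; split; apply: half => // x Cx;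
  by have [|/AB[h1 h2]] := pselect (E x); [right|left; auto].
Qed.

(** Pointwise u <= v + 1_E, because u is at most 1 and v is nonnegative. Integrate, then exchange u
    and v. *)
Lemma integral_agree_off (u v : T -> \bar R) E :
  measurable_fun setT u -> measurable_fun setT v -> measurable E ->
  (forall x, (0 <= u x <= 1)%E) -> (forall x, (0 <= v x <= 1)%E) ->
  (forall x, ~ E x -> u x = v x) ->
  `|fine (\int[P]_x u x) - fine (\int[P]_x v x)| <= fine (P E).
Proof.
move=> mu mv mE u01 v01 uv.
have fin w : measurable_fun setT w -> (forall x, (0 <= w x <= 1)%E) ->
    (\int[P]_x w x)%E \is a fin_num.
  move=> mw w01; rewrite ge0_fin_numE; last first.
    by apply: integral_ge0 => x _; case/andP: (w01 x).
  apply: (@le_lt_trans _ _ (\int[P]_x cst 1 x)%E).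
    by apply: ge0_le_integral => //= x _; case/andP: (w01 x).
  by rewrite integral_cst//= probability_setT mule1 ltry.
have half w w' : measurable_fun setT w -> measurable_fun setT w' ->
    (forall x, (0 <= w x <= 1)%E) -> (forall x, (0 <= w' x <= 1)%E) ->
    (forall x, ~ E x -> w x = w' x) ->
    fine (\int[P]_x w x) - fine (\int[P]_x w' x) <= fine (P E).
  move=> mw mw' w01 w'01 ww'.
  rewrite lerBlDl -lee_fin EFinD fine_probability// !fineK ?fin//.
  have -> : (P E = \int[P]_x (\1_E x)%:E)%E by rewrite integral_indic// setIT.
  rewrite -ge0_integralD//; last 2 first.
  - by move=> x _; case/andP: (w'01 x).
  - exact/measurable_EFinP/measurable_indic.
  apply: ge0_le_integral => //.
  - by move=> x _; case/andP: (w01 x).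
  - by apply: emeasurable_funD => //; exact/measurable_EFinP/measurable_indic.
  move=> x _; rewrite indicE; case: (asboolP (E x)) => Ex.
    rewrite mem_set//; apply: (@le_trans _ _ 1%E); first by case/andP: (w01 x).
    by rewrite leeDr//; case/andP: (w'01 x).
  by rewrite memNset// adde0 ww'.
rewrite ler_norml lerNl opprB; apply/andP; split; apply: half => // x /uv //.
Qed.

Lemma probability_decreasing_small (F : (set T)^nat) (e : R) :
  (forall n, measurable (F n)) -> (forall n, F n.+1 `<=` F n) ->
  P (\bigcap_n F n) = 0%E -> 0 < e -> exists n, (P (F n) < e%:E)%E.
Proof.
move=> mF dF F0 e0.
have cF : P \o F @ \oo --> P (\bigcap_n F n).
  apply: nonincreasing_cvg_mu => //; last 2 first.
  - exact: bigcapT_measurable.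
  - by apply/nonincreasing_seqP => n; apply/subsetPset; exact: dF.
  by rewrite (le_lt_trans (probability_le1 _ (mF 0%N)))// ltry.
rewrite F0 in cF; have /= := cF `]-oo, e%:E[%classic.
case=> [|N _ hN].
  by apply: open_nbhs_nbhs; split; [exact: lray_open|rewrite /= in_itv/= lte_fin].
by exists N; have := hN N (leqnn N); rewrite /= in_itv.
Qed.

(** The error is a set E outside which A and C agree pointwise: such agreement passes through
    Boolean operations, and errors combine by union. *)
Definition approximable (G : set (set T)) : set (set T) := [set A | measurable A /\
  forall e : R, 0 < e -> exists C E, [/\ G C, measurable E, (P E < e%:E)%E &
    forall x, ~ E x -> A x <-> C x]].

Lemma approximableC (G : set (set T)) A : (forall B, G B -> G (~` B)) ->
  approximable G A -> approximable G (~` A).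
Proof.
move=> GC [mA apA]; split => [|e e0]; first exact: measurableC.
have [C [E [GCC mE Ee AC]]] := apA e e0.
exists (~` C), E; split => //; first exact: GC.
by move=> x /AC h; split => nx ?; apply: nx; exact/h.
Qed.

Lemma approximableI (G : set (set T)) A B :
  (forall C D, G C -> G D -> G (C `&` D)) ->
  approximable G A -> approximable G B -> approximable G (A `&` B).
Proof.
move=> GI [mA apA] [mB apB]; split => [|e e0]; first exact: measurableI.
have e20 : 0 < e / 2 by rewrite divr_gt0.
have [C [E [GC mE Ee AC]]] := apA _ e20.
have [D [E' [GD mE' Ee' BD]]] := apB _ e20.
exists (C `&` D), (E `|` E'); split; [exact: GI|exact: measurableU| |].
  by rewrite (@le_lt_trans _ _ (P E + P E')%E) ?measureU2// (splitr e) EFinD lteD.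
by move=> x /= /not_orP[/AC[? ?] /BD[? ?]]; split => -[]; split; auto.
Qed.

(** The approximable sets form a sigma-algebra containing G. For a countable union, a finite
    subunion misses little by continuity from above, and finite unions reduce to complements and
    intersections. *)
Lemma generated_approximable (G : set (set T)) :
  G setT -> (forall A, G A -> G (~` A)) ->
  (forall A B, G A -> G B -> G (A `&` B)) -> G `<=` measurable ->
  <<s G >> `<=` approximable G.
Proof.
move=> GT GC GI Gm.
have apG : G `<=` approximable G.
  move=> A GA; split => [|e e0]; first exact: Gm.
  by exists A, set0; split; rewrite ?measure0.
have ap0 : approximable G set0.
  by rewrite -setCT; apply: approximableC => //; exact: apG.
apply: smallest_sub => //; split => // [A|F apF].
  by rewrite setTD; exact: approximableC.
have mF n : measurable (F n) by case: (apF n).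
pose S n := \big[setU/set0]_(i < n) F i.
have apS n : approximable G (S n).
  elim: n => [|n IH]; first by rewrite /S big_ord0.
  rewrite /S big_ord_recr /= -(setCK (_ `|` _)) setCU.
  by apply: approximableC => //; apply: approximableI => //; exact: approximableC.
have mU : measurable (\bigcup_n F n) by exact: bigcupT_measurable.
split => // e e0.
have e20 : 0 < e / 2 by rewrite divr_gt0.
have [n Sn] : exists n, (P (\bigcup_n F n `\` S n) < (e / 2)%:E)%E.
  apply: (@probability_decreasing_small (fun n => \bigcup_n F n `\` S n)) => //.
  - by move=> n; apply: measurableD => //; case: (apS n).
  - move=> n x [Ux nS]; split => // Sx; apply: nS.
    by rewrite /S big_ord_recr /=; left.
  - rewrite (_ : \bigcap_n _ = set0) ?measure0//.
    rewrite -subset0 => x h; have [[i _ Fix] _] := h 0%N I.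
    have [_] := h i.+1 I; apply; rewrite /S -bigcup_mkord.
    by exists i => /=.
have [mS /(_ _ e20)[C [E [GCC mE Ee SC]]]] := apS n.
have mUS : measurable (\bigcup_n F n `\` S n) by exact: measurableD.
exists C, (E `|` (\bigcup_n F n `\` S n)); split => //; first exact: measurableU.
  by rewrite (le_lt_trans (measureU2 _ mE mUS))// (splitr e) EFinD lteD.
move=> x /= /not_orP[/SC[h1 h2] /not_andP h]; split.
  by move=> Ux; case: h => // /contrapT /h1.
by move=> /h2; rewrite /S -bigcup_mkord => -[i _ Fix]; exists i.
Qed.

End approximation.

(** * The second moment method *)

Section small_deviation.
Context d (T : measurableType d) (R : realType) (P : probability T R).
Local Open Scope ereal_scope.

(** The term -2kX of the expanded square is moved to the other side, so that only nonnegative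
    functions are integrated and no integrability has to be checked. *)
Lemma integral_square_deviation (X : T -> R) (k m1 m2 : R) :
  measurable_fun setT X -> (forall x, 0 <= X x)%R -> (0 <= k)%R ->
  \int[P]_x (X x)%:E = m1%:E -> \int[P]_x (X x ^+ 2)%:E = m2%:E ->
  \int[P]_x ((X x - k) ^+ 2)%:E = (m2 - 2 * k * m1 + k ^+ 2)%:E.
Proof.
move=> mX X0 k0 E1 E2.
have k20 : (0 <= 2 * k)%R by rewrite mulr_ge0.
have mq : measurable_fun setT (fun x => ((X x - k) ^+ 2)%:E).
  by apply/measurable_EFinP; apply: measurable_funX; exact: measurable_funB.
have mX2 : measurable_fun setT (fun x => (X x ^+ 2)%:E).
  by apply/measurable_EFinP; exact: measurable_funX.
have mXE : measurable_fun setT (fun x => (X x)%:E) by exact/measurable_EFinP.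
have : \int[P]_x (((X x - k) ^+ 2)%:E + (2 * k)%:E * (X x)%:E) =
    \int[P]_x ((X x ^+ 2)%:E + (k ^+ 2)%:E).
  by apply: eq_integral => x _; rewrite -EFinM -!EFinD; congr EFin; ring.
rewrite ge0_integralD//; [|by move=> x _; rewrite lee_fin sqr_ge0|
  by move=> x _; rewrite lee_fin mulr_ge0|exact: measurable_funeM].
rewrite ge0_integralD//; [|by move=> x _; rewrite lee_fin sqr_ge0|
  by move=> x _; rewrite lee_fin sqr_ge0].
have -> : \int[P]_x ((2 * k)%:E * (X x)%:E) = (2 * k)%:E * m1%:E.
  by rewrite -E1; apply: ge0_integralZl_EFin => // x _; rewrite lee_fin.
rewrite E2 integral_cst//= probability_setT mule1.
case: (\int[P]_x ((X x - k) ^+ 2)%:E) => [r||]//=.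
rewrite -!EFinD => -[h]; congr EFin.
by rewrite -addrA addrCA -h; ring.
Qed.

(** If every x failed for some i, the sum over i of the squared deviations would be at least e^2
    everywhere, while its mean is at most |I| * 3b. *)
Lemma exists_small_deviation (I : finType) (X : I -> T -> R)
    (k m1 m2 : I -> R) (b e : R) :
  (forall i, measurable_fun setT (X i)) ->
  (forall i x, 0 <= X i x)%R -> (forall i, 0 <= k i <= 1)%R ->
  (forall i, \int[P]_x (X i x)%:E = (m1 i)%:E) ->
  (forall i, \int[P]_x (X i x ^+ 2)%:E = (m2 i)%:E) ->
  (forall i, `|m1 i - k i| <= b)%R -> (forall i, `|m2 i - k i ^+ 2| <= b)%R ->
  (0 < e)%R -> (#|I|%:R * (3 * b) < e ^+ 2)%R ->
  exists x, forall i, (`|X i x - k i| < e)%R.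
Proof.
move=> mX X0 k01 E1 E2 b1 b2 e0 Ib; apply: contrapT => /forallNP noX.
pose q i x := ((X i x - k i) ^+ 2)%:E.
have q0 i x : 0 <= q i x by rewrite lee_fin sqr_ge0.
have mq i : measurable_fun setT (q i).
  by apply/measurable_EFinP; apply: measurable_funX; exact: measurable_funB.
have : (e ^+ 2)%:E <= \int[P]_x \sum_i q i x.
  rewrite -[leLHS]mule1 -(probability_setT P) -integral_cst//.
  apply: ge0_le_integral => //=.
  - by move=> x _; rewrite lee_fin sqr_ge0.
  - exact: emeasurable_sum.
  move=> x _; have /existsNP[i /negP] := noX x.
  rewrite -leNgt => ei; rewrite (bigD1 i)//=.
  apply: (@le_trans _ _ (q i x)); last by rewrite leeDl// sume_ge0.
  by rewrite /q lee_fin -[leRHS]real_normK ?num_real// lerXn2r ?nnegrE// ltW.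
rewrite ge0_integral_sum//.
have : \sum_i \int[P]_x q i x <= \sum_(i : I) (3 * b)%:E.
  apply: lee_sum => i _; have /andP[ki0 ki1] := k01 i.
  rewrite (integral_square_deviation (mX i) (X0 i) ki0 (E1 i) (E2 i)) lee_fin.
  have := b1 i; have := b2 i; rewrite !ler_norml => /andP[_ h2] /andP[h1 _].
  have b0 : (0 <= b)%R by exact: le_trans (b1 i).
  (* The mean square is (m2 - k^2) - 2k (m1 - k) <= b + 2kb <= 3b; [p1] and [p2] supply the two
     products of this estimate. *)
  have p1 : (0 <= k i * (m1 i - k i + b))%R by rewrite mulr_ge0//; lra.
  have p2 : (0 <= (1 - k i) * b)%R by rewrite mulr_ge0//; lra.
  nra.
rewrite sumEFin sumr_const => /[swap] /le_trans /[apply].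
by rewrite lee_fin -[leRHS]mulr_natl => /(lt_le_trans Ib); rewrite ltxx.
Qed.

End small_deviation.

(** * Approximation of partitions by an algebra of sets *)

Section partition_approximation.
Context d (T : measurableType d) (R : realType) (P : probability T R).
Variable G : set (set T).
Hypothesis GT : G setT.
Hypothesis GC : forall A, G A -> G (~` A).
Hypothesis GI : forall A B, G A -> G B -> G (A `&` B).
Hypothesis mG : G `<=` measurable.

Let G_forall k (F : 'I_k -> set T) : (forall i, G (F i)) -> G [set x | forall i, F i x].
Proof.
move=> GF; suff H (r : seq 'I_k) : G [set x | forall i, i \in r -> F i x].
  have := H (enum 'I_k); congr G; apply/seteqP; split => x /= h i; last by move=> _.
  by apply: h; rewrite mem_enum.
elim: r => [|i r IH].
  by rewrite (_ : mkset _ = setT)//; apply/seteqP; split.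
rewrite (_ : mkset _ = F i `&` [set x | forall j, j \in r -> F j x]); first exact: GI.
apply/seteqP; split => x /= h.
  by split => [|j js]; apply: h; rewrite in_cons ?eqxx ?js ?orbT.
by case: h => Fi Fs j /predU1P[->|/Fs].
Qed.

(** The pieces are first approximated separately. Making the approximants into a partition by
    Boolean operations stays in G and changes nothing off E, where they already partition. *)
Lemma approximate_partition k (A : 'I_k -> set T) (e : R) :
  measurable `<=` <<s G >> -> measurable_partition A -> 0 < e ->
  exists B E, [/\ measurable_partition B, forall i, G (B i), measurable E,
    (P E < e%:E)%E & forall x, ~ E x -> forall i, A i x <-> B i x].
Proof.
move=> genG [mA tA cA] e0.
have [C [E [GCC mE Ee AC]]] : exists C E, [/\ forall i, G (C i), measurable E,
    (P E < e%:E)%E & forall x, ~ E x -> forall i : 'I_k, A i x <-> C i x].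
  (* Induction along the list of indices; half of the error goes to the new index, half to the
     others. *)
  suff H (r : seq 'I_k) (u : R) : 0 < u -> exists C E, [/\ forall i, G (C i),
      measurable E, (P E < u%:E)%E &
      forall x, ~ E x -> forall i, i \in r -> A i x <-> C i x].
    have [C [E [GCC mE Ee AC]]] := H (enum 'I_k) e e0.
    by exists C, E; split => // x /AC h i; apply: h; rewrite mem_enum.
  elim: r u => [|i r IH] u u0.
    by exists (fun=> setT), set0; split; rewrite ?measure0.
  have u20 : 0 < u / 2 by rewrite divr_gt0.
  have [C [E [GCC mE Ee AC]]] := IH _ u20.
  have [_ /(_ _ u20)[D [E' [GD mE' Ee' AD]]]] :=
    generated_approximable P GT GC GI mG (genG _ (mA i)).
  exists (fun j => if j == i then D else C j), (E `|` E'); split.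
  - by move=> j; case: ifP.
  - exact: measurableU.
  - by rewrite (@le_lt_trans _ _ (P E + P E')%E) ?measureU2// (splitr u) EFinD lteD.
  - move=> x /= /not_orP[nE nE'] j; rewrite in_cons.
    have [-> _|ji /= jr] := eqVneq j i; first exact: AD.
    exact: AC.
(* The point x goes to B i for the largest i such that D i x. *)
pose D (i : 'I_k) := if (i : nat) == 0%N then setT else C i.
have GD i : G (D i) by rewrite /D; case: ifP.
pose B (i : 'I_k) := D i `&` [set x | forall j : 'I_k, (if (i < j)%N then ~` C j else setT) x].
have GB i : G (B i).
  by apply: GI => //; apply: G_forall => j; case: ifP => // _; exact: GC.
have BC (i j : 'I_k) x : (i < j)%N -> B i x -> ~ D j x.
  move=> ij [_ /(_ j)]; rewrite ij /D gtn_eqF//; exact: leq_ltn_trans ij.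
have tB : trivIset setT B.
  move=> i j _ _ [x [Bi Bj]]; apply: ord_inj; case: (ltngtP i j) => // ij.
    by case: (BC _ _ x ij Bi); case: Bj.
  by case: (BC _ _ x ij Bj); case: Bi.
have AB x : ~ E x -> forall i, A i x -> B i x.
  move=> /AC ACx i Aix; split; first by rewrite /D; case: ifP => // _; exact/ACx.
  move=> j /=; case: ifP => // ij /ACx Ajx.
  have ijE : i = j by apply: tA => //; exists x.
  by move: ij; rewrite ijE ltnn.
have AT x : exists i, A i x by have := I : setT x; rewrite -cA => -[i _]; exists i.
exists B, E; split => //.
  split => //; first by move=> i; exact: mG.
  apply/seteqP; split => // x _; have [i0 _] := AT x.
  have k0 : (0 < k)%N by exact: leq_ltn_trans (leq0n i0) (ltn_ord i0).
  (* [D] is the whole space at index 0, so a largest index exists and the sets [B i] cover. *)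
  have D0 : `[< D (Ordinal k0) x >] by exact/asboolP.
  have [i /asboolP Di imax] :=
    @arg_maxnP _ (Ordinal k0) (fun i => `[< D i x >]) (fun i : 'I_k => i : nat) D0.
  exists i => //; split => // j /=; case: ifP => // ij Cj.
  have : `[< D j x >] by apply/asboolP; rewrite /D; case: ifP.
  by move=> /imax /= ji; move: (leq_trans ij ji); rewrite ltnn.
move=> x nE i; split; first exact: AB.
move=> Bi; have [j Aj] := AT x.
suff -> : i = j by [].
by apply: tB => //; exists x; split => //; exact: AB.
Qed.

End partition_approximation.

(** * Independence of disjoint blocks of an i.i.d. sequence *)

(** Elements outside t are sent beyond all values taken on t. A labelling that is injective only on
    a finite window can thus be replaced by one that is injective on all cosets. *)
Lemma injective_extension (K : countType) (t : seq K) (e : K -> nat) :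
  {in t &, injective e} ->
  exists2 E : K -> nat, injective E & {in t, E =1 e}.
Proof.
move=> einj; pose N := (\max_(k <- t) e k).+1.
have eN k : k \in t -> (e k < N)%N by move=> kt; rewrite ltnS; exact: leq_bigmax_seq.
exists (fun k => if k \in t then e k else N + pickle k)%N; last by move=> k /= ->.
move=> k l /=; case: ifP => kt; case: ifP => lt.
- exact: einj.
- by move=> kl; have := eN _ kt; rewrite kl ltnNge leq_addr.
- by move=> kl; have := eN _ lt; rewrite -kl ltnNge leq_addr.
- by move/addnI/(pcan_inj (@pickleK _)).
Qed.

Section independence.
Context d (Z : measurableType d) (R : realType) (eta : probability Z R).
Context (I J : countType).
Local Open Scope ereal_scope.

Definition fspace_case (fh : fspace I Z * fspace J Z) : fspace (I + J)%type Z :=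
  fun k => match k with inl i => fh.1 i | inr j => fh.2 j end.

Lemma measurable_fspace_case : measurable_fun setT fspace_case.
Proof.
apply: fspace_measurable_fun => -[i|j] /=.
  exact: (measurableT_comp (@fspace_measurable_proj _ _ Z i) measurable_fst).
exact: (measurableT_comp (@fspace_measurable_proj _ _ Z j) measurable_snd).
Qed.

(** Boxes determine a probability on the function space, and a box over I + J is the product of a
    box over I and a box over J. *)
Lemma product_probability_sum A : measurable A ->
  product_probability eta (I + J)%type A =
  (product_probability eta I \x product_probability eta J) (fspace_case @^-1` A).
Proof.
pose Q := image_prob (product_probability eta I \x product_probability eta J)
  measurable_fspace_case.
apply: (fspace_probability_unique (Q := Q)) => s B us mB.
rewrite product_probability_fbox//.
(* [sl] and [sr] collect the left and the right indices of s. *)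
pose sl := pmap (fun k : I + J => if k is inl i then Some i else None) s.
pose sr := pmap (fun k : I + J => if k is inr j then Some j else None) s.
have msl i : (i \in sl) = (inl i \in s).
  rewrite mem_pmap; apply/mapP/idP => [[[j|j] js //= [->]]//|si].
  by exists (inl i).
have msr i : (i \in sr) = (inr i \in s).
  rewrite mem_pmap; apply/mapP/idP => [[[j|j] js //= [->]]//|si].
  by exists (inr i).
have usl : uniq sl by apply: (@pmap_uniq _ _ _ inl) => // -[].
have usr : uniq sr by apply: (@pmap_uniq _ _ _ inr) => // -[].
rewrite [RHS](_ : _ = (product_probability eta I \x product_probability eta J)
  (fspace_case @^-1` fbox s B))//.
have -> : fspace_case @^-1` fbox s B =
    fbox sl (B \o inl) `*` fbox sr (B \o inr).
  apply/seteqP; split => -[f h] /=.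
    move=> fhB; split => i; first by rewrite msl => /fhB.
    by rewrite msr => /fhB.
  by move=> [fB hB] [i|j] ks /=; [apply: fB; rewrite msl|apply: hB; rewrite msr].
rewrite product_measure1E; [|by apply: measurable_fbox => ?; exact: mB..].
transitivity (product_probability eta I (fbox sl (B \o inl)) *
  product_probability eta J (fbox sr (B \o inr))); last by [].
rewrite !product_probability_fbox//; try by move=> ?; exact: mB.
rewrite !big_pmap; elim: s {us sl sr msl msr usl usr} => [|[i|j] s IH] /=.
- by rewrite !big_nil mule1.
- by rewrite !big_cons /= IH mul1e muleA.
- by rewrite !big_cons /= IH mul1e muleCA.
Qed.

(** An injective E reads the two families from disjoint blocks of the sequence; together they have
    the law of a family over I + J, which is a product measure. *)
Lemma iid_independent (E : I + J -> nat) A B : injective E ->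
  measurable A -> measurable B ->
  iid eta [set z | A (Defs.reindex (E \o inl) z) /\ B (Defs.reindex (E \o inr) z)] =
  product_probability eta I A * product_probability eta J B.
Proof.
move=> Einj mA mB.
pose C : set (fspace (I + J)%type Z) :=
  [set h | A (fun i => h (inl i)) /\ B (fun j => h (inr j))].
have mC : measurable C.
  apply: measurableI.
    rewrite -[X in measurable X]setTI.
    have : measurable_fun setT
        (fun (h : fspace (I + J)%type Z) => (fun i => h (inl i)) : fspace I Z).
      by apply: fspace_measurable_fun => i; exact: fspace_measurable_proj.
    by apply.
  rewrite -[X in measurable X]setTI.
  have : measurable_fun setT
      (fun (h : fspace (I + J)%type Z) => (fun i => h (inr i)) : fspace J Z).
    by apply: fspace_measurable_fun => i; exact: fspace_measurable_proj.
  by apply.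
rewrite -product_measure1E//.
transitivity (iid eta (Defs.reindex E @^-1` C)) => //.
by rewrite reindex_iid// product_probability_sum.
Qed.

End independence.

(** * Labellings and equivariant maps into the joining *)

(** The sets are the preimages of the balls of radius 1/(n+1) about the points of a countable dense
    set. *)
Lemma standard_borel_separating (R : realType) d (Y : measurableType d) :
  standard_borel R Y -> exists U : nat -> set Y, (forall n, measurable (U n)) /\
    forall y y', (forall n, U n y <-> U n y') -> y = y'.
Proof.
move=> [X [phi [[D /countable_injP[h hinj] dD] _ bphi mE]]].
have oB (x : X) (r : R) : open [set y | mdist x y < r].
  rewrite openE => y /= xyr; apply/nbhs_ballP; exists (r - mdist x y) => /=.
    by rewrite subr_gt0.
  rewrite ballEmdist => z /=; rewrite ltrBrDl => yz.
  exact: le_lt_trans (metric_triangle _ _ _) yz.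
have mB (x : X) (r : R) : measurable [set y | mdist x (phi y) < r].
  rewrite mE; exists [set y | mdist x y < r] => //.
  by apply: sub_sigma_algebra; exact: oB.
(* The ball about the dense point numbered i by h, or the empty set if there is no such point. *)
pose U i n := [set y | exists x, [/\ D x, h x = i & mdist x (phi y) < n.+1%:R^-1]].
have mU i n : measurable (U i n).
  have [[x [Dx hx]]|nx] := pselect (exists x, D x /\ h x = i); last first.
    rewrite (_ : U i n = set0)// -subset0 => y [x [Dx hx _]].
    by apply: nx; exists x.
  rewrite (_ : U i n = [set y | mdist x (phi y) < n.+1%:R^-1])//.
  apply/seteqP; split => y; last by exists x.
  move=> [x' [Dx' hx' /=]]; rewrite (_ : x' = x)//.
  by apply: hinj; [exact/mem_set|exact/mem_set|rewrite hx'].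
exists (fun k => if unpickle k is Some (i, n) then U i n else set0); split.
  by move=> k; case: unpickle => [[]|].
move=> y y' yy'; apply: (bij_inj bphi); apply/eqP; apply: contraT.
rewrite -mdist_gt0 => d0.
(* With this radius no ball contains both points, by the triangle inequality. *)
have [n hn] : exists n, n.+1%:R^-1 < mdist (phi y) (phi y') / 2.
  have h0 : 0 < mdist (phi y) (phi y') / 2 by rewrite divr_gt0.
  by have [n] := ltr_add_invr h0; rewrite add0r; exists n.
have [x [/= yx Dx]] : [set z | mdist (phi y) z < n.+1%:R^-1] `&` D !=set0.
  apply: dD; last exact: oB.
  by exists (phi y); rewrite /= mdistxx invr_gt0.
have : U (h x) n y by exists x; split => //; rewrite metric_sym.
have := yy' (pickle (h x, n)); rewrite pickleK => -[+ _] => /[apply] -[x' [Dx' hx]].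
have -> : x' = x by apply: hinj; [exact/mem_set|exact/mem_set|].
move=> xy'; have := le_lt_trans (metric_triangle (phi y) x (phi y')) (ltrD yx xy').
by rewrite ltNge => /negP[]; rewrite [leRHS]splitr ltW// ltrD.
Qed.

(** [p n y] codes in binary which of the first n separating sets contain y. The newest bit is the
    lowest, so halving recovers the previous label and parity the last membership. *)
Lemma standard_borel_labelling (R : realType) d (Y : measurableType d) :
  standard_borel R Y -> exists p : nat -> Y -> nat,
    [/\ forall n, measurable_fun setT (p n),
        forall n y y', p n.+1 y = p n.+1 y' -> p n y = p n y' &
        forall y y', (forall n, p n y = p n y') -> y = y'].
Proof.
move=> /standard_borel_separating[U [mU sU]].
pose p := fix p n y := if n is m.+1 then (`[< U m y >] + (p m y).*2)%N else 0%N.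
have pS n y y' : p n.+1 y = p n.+1 y' -> p n y = p n y' /\ (U n y <-> U n y').
  move=> /= pyy'; split.
    by rewrite -(half_bit_double (p n y) `[< U n y >]) pyy' half_bit_double.
  have := congr1 odd pyy'; rewrite !oddD !odd_double !addbF !oddb => UU.
  by split => /asboolP; [rewrite UU|rewrite -UU] => /asboolP.
exists p; split.
- elim=> [|n IH]; first exact: measurable_cst.
  move=> _ B _; rewrite setTI (_ : _ @^-1` B =
      (U n `&` p n @^-1` [set m | B (true + m.*2)%N]) `|`
      (~` U n `&` p n @^-1` [set m | B (false + m.*2)%N])).
    apply: measurableU; apply: measurableI => //; try exact: measurableC;
      by rewrite -[X in measurable X]setTI; exact: IH.
  apply/seteqP; split => y /=.
    by case: asboolP => Uy By; [left|right].
  by move=> [] [Uy By]; [rewrite asboolT|rewrite asboolF].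
- by move=> n y y' /pS[].
- by move=> y y' pyy'; apply: sU => n; have [] := pS n y y' (pyy' n.+1).
Qed.

Section labelled_point.
Context (R : realType) (G : countGroupType) dY (Y : measurableType dY)
  (hY : standard_borel R Y) (a : mp_action R G Y) dZ (Z : measurableType dZ).
Local Notation X := (coset_fspace G Z).
Local Notation W := (fspace nat Z).
Implicit Types (p : Y -> nat).

(** The map G_y g |-> g^-1 y identifies the right cosets of the stabilizer with the orbit of y, so a
    label of points is also a label of cosets. *)
Definition coset_label p y (C : coset (stabilizer a y)) : nat :=
  p (a (coset_repr C)^-1%g y).

Lemma coset_labelE p y g :
  coset_label p (mkcoset (stabilizer a y) g) = p (a g^-1%g y).
Proof.
rewrite /coset_label; set c := coset_repr _; congr (p _).
have : sval (mkcoset (stabilizer a y) c) c by exact: mem_mkcoset.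
rewrite coset_reprK /= right_cosetE /= => cg.
by rewrite -[in LHS]cg -actM mulgA mulVg mul1g.
Qed.

(** This is Phi_z(y). *)
Definition labelled_point p (z : W) y : X * Y :=
  (existT _ (stabilizer a y) (Defs.reindex (coset_label p (y := y)) z), y).

Lemma labelled_point_inj p z y : coset_fspace_inj (labelled_point p z y).1 =
  ((fun g => z (p (a g^-1%g y))), stabilizer a y).
Proof.
rewrite /coset_fspace_inj /=; congr pair; apply/funext => g.
by rewrite /Defs.reindex /= coset_labelE.
Qed.

(** The coset of d at g y and the coset of g^-1 d at y carry the same label, since d^-1 (g y) =
    (g^-1 d)^-1 y. *)
Lemma labelled_point_act p z g y :
  labelled_point p z (a g y) = joining_act a g (labelled_point p z y).
Proof.
rewrite /joining_act [LHS]surjective_pairing; congr pair.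
apply: coset_fspace_injP; rewrite labelled_point_inj coset_fspace_inj_shift.
rewrite labelled_point_inj /= stabilizer_act; congr pair; apply/funext => c /=.
by rewrite invgM invgK actM.
Qed.

Lemma measurable_labelled_point p : measurable_fun setT p ->
  measurable_fun setT (fun zy : W * Y => labelled_point p zy.1 zy.2).
Proof.
move=> mp; apply: measurable_fun_pair => //.
apply: coset_fspace_measurable_fun => [g|]; last first.
  exact: (measurableT_comp (measurable_stabilizer a hY) measurable_snd).
rewrite (_ : (fun t => _) = fun zy : W * Y => zy.1 (p (a g^-1%g zy.2))); last first.
  by apply/funext => -[z y] /=; rewrite /Defs.reindex /= coset_labelE.
move=> _ B mB; rewrite setTI.
have mc : measurable_fun setT (fun zy : W * Y => p (a g^-1%g zy.2)).
  by apply: (measurableT_comp mp); apply: (measurableT_comp (measurable_act a _)).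
(* The coordinate of z that is read varies with y; split according to its countably many values. *)
rewrite (_ : _ @^-1` B = \bigcup_n ((fun zy : W * Y => p (a g^-1%g zy.2)) @^-1` [set n]
   `&` [set zy : W * Y | B (zy.1 n)])).
  apply: bigcupT_measurable => n; apply: measurableI.
    by rewrite -[X in measurable X]setTI; exact: mc.
  rewrite -[X in measurable X]setTI.
  exact: (measurableT_comp (@fspace_measurable_proj nat _ Z n) measurable_fst).
apply/seteqP; split => -[z y] /=; first by move=> Bz; exists (p (a g^-1%g y)).
by move=> [n _ [/= <-]].
Qed.

End labelled_point.

(** * Sets depending on finitely many cosets *)

Section windowed.
Context (R : realType) (G : countGroupType) dY (Y : measurableType dY)
  (hY : standard_borel R Y) (a : mp_action R G Y) dZ (Z : measurableType dZ).
Local Notation X := (coset_fspace G Z).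
Local Notation W := (fspace nat Z).
Implicit Types (C : set (X * Y)) (s : seq G) (p : Y -> nat) (y : Y).

(* C depends on y and f only through y, H_f and the values f (H_f g), g in s. *)
Definition windowed s C := forall f f' y, base f = base f' ->
  {in s, (coset_fspace_inj f).1 =1 (coset_fspace_inj f').1} -> C (f, y) -> C (f', y).

Lemma sub_windowed s s' C : {subset s <= s'} -> windowed s C -> windowed s' C.
Proof. by move=> ss' wC f f' y bf ff'; apply: wC => // g /ss' /ff'. Qed.

Lemma windowedC s C : windowed s C -> windowed s (~` C).
Proof.
move=> wC f f' y bf ff' nC Cf'; apply: nC; apply: wC Cf' => //.
by move=> g /ff'.
Qed.

Lemma windowedI s C C' : windowed s C -> windowed s C' -> windowed s (C `&` C').
Proof. by move=> wC wC' f f' y bf ff' [? ?]; split; [exact: wC ff' _|exact: wC' ff' _]. Qed.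

(** The value of the shifted function at c is the value of f at g^-1 c, so the window is
    translated. *)
Lemma windowed_act g s C : windowed s C ->
  windowed [seq (g^-1 * c)%g | c <- s] (joining_act a g @^-1` C).
Proof.
move=> wC f f' y bf ff'; rewrite /joining_act /=; apply: wC.
  by rewrite /base /= -/(base f) -/(base f') bf.
move=> c sc; rewrite !coset_fspace_inj_shift /=.
exact: (ff' _ (map_f (fun c => g^-1 * c)%g sc)).
Qed.

(** Inverses occur because the coset of g corresponds to g^-1 y. The first two clauses let labels
    coincide only when the points do; the third makes the labels used by y and by y' disjoint. *)
Definition label_separated p s y y' :=
  [/\ {in s &, forall g h, p (a g^-1%g y) = p (a h^-1%g y) -> a g^-1%g y = a h^-1%g y},
      {in s &, forall g h, p (a g^-1%g y') = p (a h^-1%g y') -> a g^-1%g y' = a h^-1%g y'} &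
      {in s &, forall g h, p (a g^-1%g y) <> p (a h^-1%g y')}].

(** Both events read only the cosets in the window, where the labelling is injective. An injective
    extension to all cosets of both points leaves the events unchanged and makes the two families
    independent. *)
Lemma iid_labelled_point (eta : probability Z R) p s C1 C2 y y' :
  measurable C1 -> measurable C2 -> windowed s C1 -> windowed s C2 ->
  label_separated p s y y' ->
  iid eta [set z | C1 (labelled_point a p z y) /\ C2 (labelled_point a p z y')] =
  (bernoulli_at eta (stabilizer a y) (ysection C1 y) *
   bernoulli_at eta (stabilizer a y') (ysection C2 y'))%E.
Proof.
move=> mC1 mC2 w1 w2 [sy sy' syy'].
pose H := stabilizer a y; pose K := stabilizer a y'.
pose e (k : coset H + coset K) :=
  match k with inl c => coset_label p c | inr c => coset_label p c end.
pose t : seq (coset H + coset K) :=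
  [seq inl (mkcoset H g) | g <- s] ++ [seq inr (mkcoset K g) | g <- s].
(* Separation yields equality of orbit points, whereas injectivity of [e] on [t] is about cosets. *)
have orbit_coset x g h : a g^-1%g x = a h^-1%g x ->
    mkcoset (stabilizer a x) g = mkcoset (stabilizer a x) h.
  by move=> gh; apply: mkcoset_eq; rewrite /= actM -gh -actM mulgV act1.
have [|E Einj Ee] := @injective_extension _ t e.
  move=> k l; rewrite !mem_cat => /orP[] /mapP[g gs ->] /orP[] /mapP[h hs ->] /=;
    rewrite !coset_labelE.
  - by move=> /sy gh; rewrite /H (orbit_coset y g h)//; exact: gh.
  - by move=> /syy' [].
  - by move=> /esym /syy' [].
  - by move=> /sy' gh; rewrite /K (orbit_coset y' g h)//; exact: gh.
have mB C u : measurable C ->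
    measurable (existT _ (stabilizer a u) @^-1` ysection C u :
      set (fspace (coset (stabilizer a u)) Z)).
  move=> mC; rewrite -[X in measurable X]setTI; apply: measurable_inclusion => //.
  exact: measurable_ysection.
rewrite -[RHS](iid_independent eta Einj (mB _ y mC1) (mB _ y' mC2)).
congr (iid eta _); apply/funext => z; rewrite /mkset /= /ysection /= !inE.
have key C u (E' : coset (stabilizer a u) -> nat) : windowed s C ->
    (forall g, g \in s -> E' (mkcoset _ g) = p (a g^-1%g u)) ->
    C (labelled_point a p z u) = C (existT _ (stabilizer a u) (Defs.reindex E' z), u).
  move=> wC E'p; apply/propext; split; apply: wC => // g gs;
    by rewrite labelled_point_inj /= /Defs.reindex /= E'p.
congr and; apply: key => // g gs; rewrite /= Ee /= ?coset_labelE// mem_cat.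
  by rewrite map_f.
by rewrite orbC map_f.
Qed.

End windowed.

Lemma measurable_seq_forall d (T : measurableType d) (I : eqType) (s : seq I)
    (F : I -> set T) : (forall i, measurable (F i)) ->
  measurable [set x | forall i, i \in s -> F i x].
Proof.
move=> mF; elim: s => [|i s IH].
  by rewrite (_ : mkset _ = setT)//; apply/seteqP; split.
rewrite (_ : mkset _ = F i `&` [set x | forall j, j \in s -> F j x]).
  exact: measurableI.
apply/seteqP; split => x /= h.
  by split => [|j js]; apply: h; rewrite in_cons ?eqxx ?js ?orbT.
by case: h => Fi Fs j /predU1P[->|/Fs].
Qed.

Lemma measurable_eq_nat d (T : measurableType d) (f g : T -> nat) :
  measurable_fun setT f -> measurable_fun setT g -> measurable [set x | f x = g x].
Proof.
move=> mf mg; rewrite (_ : mkset _ = \bigcup_n (f @^-1` [set n] `&` g @^-1` [set n])).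
  apply: bigcupT_measurable => n; apply: measurableI;
    by rewrite -[X in measurable X]setTI; (apply: mf || apply: mg).
apply/seteqP; split => x /= => [fg|[n _ [-> ->]]//].
by exists (g x).
Qed.

(** Labels only get finer, so two distinct points stay apart from some stage on; a maximum serves
    finitely many pairs. *)
Lemma labels_separate (T : eqType) (p : nat -> T -> nat) (M : seq (T * T)) :
  (forall n y y', p n.+1 y = p n.+1 y' -> p n y = p n y') ->
  (forall y y', (forall n, p n y = p n y') -> y = y') ->
  exists n, forall u v, (u, v) \in M -> p n u = p n v -> u = v.
Proof.
move=> pS pinj.
have pm n m y y' : (n <= m)%N -> p m y = p m y' -> p n y = p n y'.
  by move=> /subnK <-; elim: (m - n)%N => // k IH /pS.
elim: M => [|[u v] M [n hn]]; first by exists 0%N.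
have [->|uv] := pselect (u = v).
  by exists n => u' v'; rewrite in_cons => /predU1P[[-> ->]//|]; exact: hn.
have [m hm] : exists m, p m u <> p m v by apply/existsNP => /pinj.
exists (maxn n m) => u' v'; rewrite in_cons => /predU1P[[-> ->]|/hn uv'].
  by move/(pm _ _ _ _ (leq_maxr n m)).
by move/(pm _ _ _ _ (leq_maxl n m)).
Qed.

(** * Pairs of points that a labelling fails to separate *)

Section unseparated.
Context (R : realType) (G : countGroupType) dY (Y : measurableType dY)
  (hY : standard_borel R Y) (a : mp_action R G Y).
Local Notation nu := (mp_measure a).
Implicit Types (s : seq G) (p : Y -> nat).
Local Open Scope ereal_scope.

Definition unseparated p s : set (Y * Y) := [set yy | ~ label_separated a p s yy.1 yy.2].

Lemma measurable_unseparated p s :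
  measurable_fun setT p -> measurable (unseparated p s).
Proof.
move=> mp; apply: (@measurableC _ _ [set yy | label_separated a p s yy.1 yy.2]).
have mp1 g : measurable_fun setT (fun yy : Y * Y => p (a g yy.1)).
  exact: (measurableT_comp mp (measurableT_comp (measurable_act a g) measurable_fst)).
have mp2 g : measurable_fun setT (fun yy : Y * Y => p (a g yy.2)).
  exact: (measurableT_comp mp (measurableT_comp (measurable_act a g) measurable_snd)).
(* This is the set of fixed points of h g^-1. *)
have meq g h : measurable [set y | a g^-1%g y = a h^-1%g y].
  rewrite (_ : mkset _ = [set y | a (h * g^-1)%g y = y]).
    exact: (measurable_fixpoints hY (measurable_act a _)).
  apply/seteqP; split => y /=; rewrite actM.
    by move=> ->; rewrite -actM mulgV act1.
  by move=> /(congr1 (a h^-1%g)); rewrite -actM mulVg act1.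
have mfst (A : set Y) : measurable A -> measurable [set yy : Y * Y | A yy.1].
  by move=> mA; rewrite -[X in measurable X]setTI; exact: measurable_fst.
have msnd (A : set Y) : measurable A -> measurable [set yy : Y * Y | A yy.2].
  by move=> mA; rewrite -[X in measurable X]setTI; exact: measurable_snd.
have mimp (A B : set (Y * Y)) : measurable A -> measurable B ->
    measurable [set x | A x -> B x].
  move=> mA mB; rewrite (_ : mkset _ = ~` A `|` B).
    by apply: measurableU => //; exact: measurableC.
  apply/seteqP; split => x /=; last by case.
  by have [Ax|nAx] := pselect (A x); [move=> /(_ Ax); right|left].
pose Q1 g h := [set yy : Y * Y | p (a g^-1%g yy.1) = p (a h^-1%g yy.1) ->
   a g^-1%g yy.1 = a h^-1%g yy.1].
pose Q2 g h := [set yy : Y * Y | p (a g^-1%g yy.2) = p (a h^-1%g yy.2) ->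
   a g^-1%g yy.2 = a h^-1%g yy.2].
pose Q3 g h := [set yy : Y * Y | p (a g^-1%g yy.1) <> p (a h^-1%g yy.2)].
rewrite (_ : mkset _ =
  [set x | forall g, g \in s -> [set x | forall h, h \in s -> Q1 g h x] x] `&`
  ([set x | forall g, g \in s -> [set x | forall h, h \in s -> Q2 g h x] x] `&`
  [set x | forall g, g \in s -> [set x | forall h, h \in s -> Q3 g h x] x])).
  apply: measurableI; last apply: measurableI;
    do 2 (apply: measurable_seq_forall => ?).
  - by apply: mimp; [exact: measurable_eq_nat|exact: (mfst _ (meq _ _))].
  - by apply: mimp; [exact: measurable_eq_nat|exact: (msnd _ (meq _ _))].
  - by apply: measurableC; exact: measurable_eq_nat.
apply/seteqP; split => yy.
  by move=> [h1 h2 h3]; split; [|split] => g gs h hs; [exact: h1|exact: h2|exact: h3].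
by move=> [h1 [h2 h3]]; split => g h gs hs; [exact: h1|exact: h2|exact: h3].
Qed.

(** A subset of a singleton is empty or everything, so its measure is never strictly in between. The
    singleton is measurable as the fixed-point set of a constant map. *)
Lemma non_atomic_singleton y : non_atomic nu -> nu [set y] = 0.
Proof.
move=> na; have my : measurable [set y].
  rewrite (_ : [set y] = [set x | cst y x = x]).
    exact: (measurable_fixpoints hY (measurable_cst y)).
  by apply/seteqP; split => x /= ->.
apply/eqP; apply: contraT; rewrite -measure_gt0 => y0.
have [B [mB By B0 By0]] := na _ my y0.
have [B00|/set0P[x Bx]] := eqVneq B set0; first by move: B0; rewrite B00 measure0 ltxx.
suff BE : B = [set y] by move: By0; rewrite BE ltxx.
by apply/seteqP; split => // z ->; rewrite -(By _ Bx).
Qed.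

(* A pair that is unseparated by all the labellings lies in the orbit relation,
   which is null because its sections are countable and nu is non-atomic. *)
Lemma unseparated_small (p : nat -> Y -> nat) s (e : R) :
  (forall n, measurable_fun setT (p n)) ->
  (forall n y y', p n.+1 y = p n.+1 y' -> p n y = p n y') ->
  (forall y y', (forall n, p n y = p n y') -> y = y') ->
  non_atomic nu -> (0 < e)%R ->
  exists n, (nu \x nu) (unseparated (p n) s) < e%:E.
Proof.
move=> mp pS pinj na e0.
have mU n : measurable (unseparated (p n) s) by exact: measurable_unseparated.
apply: (probability_decreasing_small (P := nu \x nu)) => //.
  move=> n [y y'] ns [h1 h2 h3]; apply: ns.
  split => g h gs hs /= /pS; [exact: h1|exact: h2|exact: h3].
have sub y : xsection (\bigcap_n unseparated (p n) s) y `<=`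
    \bigcup_n (if unpickle n is Some g then [set a g y] else set0 : set Y).
  move=> y'; rewrite /xsection /= inE => yy'.
  suff [g [h gh]] : exists g h, a g^-1%g y = a h^-1%g y'.
    exists (pickle (h * g^-1)%g) => //; rewrite pickleK /=.
    by rewrite actM gh -actM mulgV act1.
  apply: contrapT => /forallNP nyy'.
  (* If y' were outside the orbit of y, a stage separating all the window points in [L] would
     separate the pair. *)
  pose L := [seq a g^-1%g y | g <- s] ++ [seq a g^-1%g y' | g <- s].
  have [n hn] := labels_separate [seq (u, v) | u <- L, v <- L] pS pinj.
  have LL u v : u \in L -> v \in L -> p n u = p n v -> u = v.
    move=> uL vL; apply: hn; exact: allpairs_f.
  have Ly g : g \in s -> a g^-1%g y \in L.
    by move=> gs; rewrite mem_cat; apply/orP; left; apply/mapP; exists g.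
  have Ly' g : g \in s -> a g^-1%g y' \in L.
    by move=> gs; rewrite mem_cat; apply/orP; right; apply/mapP; exists g.
  apply: (yy' n I); split => g h gs hs /=.
  - by apply: LL; exact: Ly.
  - by apply: LL; exact: Ly'.
  - by move=> pgh; apply: (nyy' g); exists h; apply: LL pgh; [exact: Ly|exact: Ly'].
have nul y : nu.-negligible
    (\bigcup_n (if unpickle n is Some g then [set a g y] else set0 : set Y)).
  apply: negligible_bigcup => n; case: unpickle => [g|]; last exact: negligible_set0.
  exists [set a g y]; split => //; last exact: non_atomic_singleton.
  rewrite (_ : [set a g y] = [set x | cst (a g y) x = x]).
    exact: (measurable_fixpoints hY (measurable_cst _)).
  by apply/seteqP; split => x /= ->.
rewrite [LHS]integral0_eq// => y _; apply: measure_negligible.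
  by apply: measurable_xsection; exact: bigcapT_measurable.
exact: negligibleS (sub y) (nul y).
Qed.

End unseparated.

(** The two orders of integration give measures that agree on rectangles. *)
Lemma product_measure12E d1 d2 (T1 : measurableType d1) (T2 : measurableType d2)
    (R : realType) (m1 : probability T1 R) (m2 : probability T2 R) A :
  measurable A -> (m1 \x m2)%E A = (m1 \x^ m2)%E A.
Proof.
move=> mA; apply: (product_measure_unique (m' := (m1 \x^ m2)%E)) => // B C mB mC.
exact: product_measure2E.
Qed.

(** * Moments of nu (Phi_z^-1 C) for random z *)

Section labelled_moment.
Context (R : realType) (G : countGroupType) dY (Y : measurableType dY)
  (hY : standard_borel R Y) (a : mp_action R G Y) dZ (Z : measurableType dZ)
  (eta : probability Z R).
Local Notation X := (coset_fspace G Z).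
Local Notation W := (fspace nat Z).
Local Notation nu := (mp_measure a).
Local Notation kappa := (joining_measure a hY eta).
Implicit Types (C : set (X * Y)) (s : seq G) (p : Y -> nat).
Local Open Scope ereal_scope.

Lemma joining_measure_ysection C : measurable C -> kappa C =
  \int[nu]_y bernoulli_at eta (stabilizer a y) (ysection C y).
Proof.
by move=> mC; rewrite joining_measureE; apply: eq_integral => y _; exact: prod_diracE.
Qed.

Lemma measurable_labelled_preimage p C : measurable_fun setT p -> measurable C ->
  measurable [set zy : W * Y | C (labelled_point a p zy.1 zy.2)].
Proof.
by move=> mp mC; rewrite -[X in measurable X]setTI; exact: measurable_labelled_point.
Qed.

(* The square of nu (Phi_z^-1 C) is an integral over pairs (y, y'), hence its mean
   over z is computed by Fubini from the two-point probabilities. *)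
Lemma labelled_moment p s C1 C2 : measurable_fun setT p ->
  measurable C1 -> measurable C2 -> windowed s C1 -> windowed s C2 ->
  (`|fine (\int[iid eta]_z (nu (labelled_point a p z @^-1` C1) *
                            nu (labelled_point a p z @^-1` C2))) -
     fine (kappa C1) * fine (kappa C2)| <= fine ((nu \x nu) (unseparated a p s)))%R.
Proof.
move=> mp mC1 mC2 w1 w2.
pose P1 (zyy : W * (Y * Y)) := labelled_point a p zyy.1 zyy.2.1.
pose P2 (zyy : W * (Y * Y)) := labelled_point a p zyy.1 zyy.2.2.
have mP1 : measurable_fun setT P1.
  have mq : measurable_fun setT (fun zyy : W * (Y * Y) => (zyy.1, zyy.2.1)).
    apply: measurable_fun_pair => //.
    exact: (measurableT_comp measurable_fst measurable_snd).
  exact: (measurableT_comp (measurable_labelled_point hY a mp) mq).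
have mP2 : measurable_fun setT P2.
  have mq : measurable_fun setT (fun zyy : W * (Y * Y) => (zyy.1, zyy.2.2)).
    apply: measurable_fun_pair => //.
    exact: (measurableT_comp measurable_snd measurable_snd).
  exact: (measurableT_comp (measurable_labelled_point hY a mp) mq).
pose D := P1 @^-1` C1 `&` P2 @^-1` C2.
have mD : measurable D.
  apply: measurableI; rewrite -[X in measurable X]setTI; [exact: mP1|exact: mP2].
have mm z C : measurable C -> measurable (labelled_point a p z @^-1` C).
  move=> mC; have := measurable_xsection z (measurable_labelled_preimage mp mC).
  by congr measurable; apply/seteqP; split => y; rewrite /xsection /= inE.
have -> : \int[iid eta]_z (nu (labelled_point a p z @^-1` C1) *
                          nu (labelled_point a p z @^-1` C2)) =
    \int[nu \x nu]_yy iid eta (ysection D yy).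
  (* For fixed z, the product of the two masses is the nu x nu mass of the section of [D] at z. *)
  transitivity ((iid eta \x (nu \x nu)) D).
    apply: eq_integral => z _ /=.
    rewrite -product_measure1E; [|exact: mm..].
    congr (_ _); apply/seteqP; split => -[y y']; rewrite /xsection /= inE //.
  transitivity ((iid eta \x^ (nu \x nu)) D) => //.
  exact: product_measure12E.
pose h C y := bernoulli_at eta (stabilizer a y) (ysection C y).
have mh C : measurable C -> measurable_fun setT (h C).
  by move=> mC; exact: measurable_bernoulli_at_section (measurable_stabilizer a hY) mC.
have h0 C y : 0 <= h C y by exact: measure_ge0.
have h1 C y : measurable C -> h C y <= 1.
  by move=> mC; apply: probability_le1; exact: measurable_ysection.
(* The product of the joining measures is also written as an integral over pairs; the two integrands
   agree on separated pairs. *)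
have -> : (fine (kappa C1) * fine (kappa C2))%R =
    fine (\int[nu \x nu]_yy (h C1 yy.1 * h C2 yy.2)).
  rewrite fubini_tonelli1//; last 2 first.
  - apply: emeasurable_funM.
      exact: (measurableT_comp (mh _ mC1) measurable_fst).
    exact: (measurableT_comp (mh _ mC2) measurable_snd).
  - by move=> yy; exact: mule_ge0.
  rewrite (eq_integral (fun y => h C1 y * \int[nu]_y' h C2 y')); last first.
    move=> y _; rewrite /fubini_F /=; apply: ge0_integralZl => //; exact: mh.
  rewrite ge0_integralZr//; [|exact: mh|exact: integral_ge0].
  by rewrite -!joining_measure_ysection// fineM//; exact: fin_num_measure.
apply: integral_agree_off.
- exact: measurable_fun_ysection.
- apply: emeasurable_funM.
    exact: (measurableT_comp (mh _ mC1) measurable_fst).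
  exact: (measurableT_comp (mh _ mC2) measurable_snd).
- exact: measurable_unseparated.
- move=> yy; rewrite measure_ge0 probability_le1//; exact: measurable_ysection.
- move=> yy; rewrite mule_ge0//=.
  by rewrite -[leRHS]mule1 lee_pmul// h1.
- move=> [y y'] /contrapT sep; rewrite /h -(iid_labelled_point eta mC1 mC2 w1 w2 sep).
  congr (iid eta _); apply/seteqP; split => z; rewrite /ysection /= inE //.
Qed.

End labelled_moment.

Section exists_labelling.
Context (R : realType) (G : countGroupType) dY (Y : measurableType dY)
  (hY : standard_borel R Y) (a : mp_action R G Y) dZ (Z : measurableType dZ)
  (eta : probability Z R).
Local Notation X := (coset_fspace G Z).
Local Notation nu := (mp_measure a).
Local Notation kappa := (joining_measure a hY eta).
Implicit Types (C : set (X * Y)) (s : seq G).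

Lemma measurable_labelled_point1 p (z : fspace nat Z) : measurable_fun setT p ->
  measurable_fun setT (labelled_point a p z).
Proof.
move=> mp; apply: (measurableT_comp (measurable_labelled_point hY a mp)
  (g := fun y => (z, y))).
by apply: measurable_fun_pair => //; exact: measurable_cst.
Qed.

Definition labelled_mass p (z : fspace nat Z) C : R :=
  fine (nu (labelled_point a p z @^-1` C)).

Lemma labelled_massE p z C : measurable_fun setT p -> measurable C ->
  (labelled_mass p z C)%:E = nu (labelled_point a p z @^-1` C).
Proof.
move=> mp mC; apply: fine_probability.
by rewrite -[X in measurable X]setTI; exact: measurable_labelled_point1.
Qed.

Lemma labelled_massT p z : labelled_mass p z setT = 1.
Proof. exact: (congr1 fine (probability_setT nu)). Qed.

Lemma labelled_mass_itv p z C : measurable_fun setT p -> measurable C ->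
  0 <= labelled_mass p z C <= 1.
Proof.
move=> mp mC; rewrite fine_ge0//= -lee_fin labelled_massE//.
apply: probability_le1.
by rewrite -[X in measurable X]setTI; exact: measurable_labelled_point1.
Qed.

Lemma measurable_labelled_mass p C : measurable_fun setT p -> measurable C ->
  measurable_fun setT (labelled_mass p ^~ C).
Proof.
move=> mp mC; apply/measurable_EFinP.
rewrite (_ : EFin \o _ = nu \o xsection [set zy | C (labelled_point a p zy.1 zy.2)]).
  by apply: measurable_fun_xsection; exact: measurable_labelled_preimage.
apply/funext => z /=; rewrite labelled_massE//; congr (nu _).
by apply/seteqP; split => y; rewrite /xsection /= inE.
Qed.

(** With C2 the whole space this estimates the mean of the mass of C1, and with C2 = C1 its second
    moment. *)
Lemma labelled_mass_moment p s C1 C2 : measurable_fun setT p ->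
  measurable C1 -> measurable C2 -> windowed s C1 -> windowed s C2 ->
  exists2 m : R, (\int[iid eta]_z (labelled_mass p z C1 * labelled_mass p z C2)%:E = m%:E)%E &
    `|m - fine (kappa C1) * fine (kappa C2)| <= fine ((nu \x nu)%E (unseparated a p s)).
Proof.
move=> mp mC1 mC2 w1 w2.
have E z : (labelled_mass p z C1 * labelled_mass p z C2)%:E =
    (nu (labelled_point a p z @^-1` C1) * nu (labelled_point a p z @^-1` C2))%E.
  by rewrite EFinM !labelled_massE.
have mass01 z : 0 <= labelled_mass p z C1 * labelled_mass p z C2 <= 1.
  have /andP[? ?] := labelled_mass_itv z mp mC1.
  have /andP[? ?] := labelled_mass_itv z mp mC2.
  by rewrite mulr_ge0//= mulr_ile1.
have fin : (\int[iid eta]_z (labelled_mass p z C1 * labelled_mass p z C2)%:E)%E \is a fin_num.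
  rewrite ge0_fin_numE; last first.
    by apply: integral_ge0 => z _; rewrite lee_fin; case/andP: (mass01 z).
  apply: (@le_lt_trans _ _ (\int[iid eta]_z cst 1 z)%E).
    apply: ge0_le_integral => //.
    - by move=> z _; rewrite lee_fin; case/andP: (mass01 z).
    - apply/measurable_EFinP.
      by apply: measurable_funM; exact: measurable_labelled_mass.
    - by move=> z _; rewrite lee_fin; case/andP: (mass01 z).
  by rewrite integral_cst//= probability_setT mule1 ltry.
have IE : (\int[iid eta]_z (labelled_mass p z C1 * labelled_mass p z C2)%:E =
    \int[iid eta]_z (nu (labelled_point a p z @^-1` C1) *
                     nu (labelled_point a p z @^-1` C2)))%E.
  by apply: eq_integral => z _; exact: E.
exists (fine (\int[iid eta]_z (nu (labelled_point a p z @^-1` C1) *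
                               nu (labelled_point a p z @^-1` C2)))%E).
  by rewrite -IE fineK.
exact: labelled_moment.
Qed.

(** The labelling is fixed first, fine enough for both moments of every C i to be within b of those
    of a constant; the second moment method then provides z. *)
Lemma exists_labelling (I : finType) (C : I -> set (X * Y)) s (e : R) :
  non_atomic nu -> (forall i, measurable (C i)) -> (forall i, windowed s (C i)) ->
  0 < e -> exists p (z : fspace nat Z), measurable_fun setT p /\
    forall i, `|labelled_mass p z (C i) - fine (kappa (C i))| < e.
Proof.
move=> na mC wC e0.
have [p [mp pS pinj]] := standard_borel_labelling hY.
(* Chosen so that |I| * 3b = e^2 |I| / (|I| + 1) < e^2; the successor also covers an empty I. *)
pose b := e ^+ 2 / (#|I|.+1%:R * 3).
have b0 : 0 < b by rewrite divr_gt0 ?exprn_gt0// mulr_gt0.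
have [n bn] := unseparated_small hY s mp pS pinj na b0.
have {}bn : fine ((nu \x nu)%E (unseparated a (p n) s)) <= b.
  by rewrite -lee_fin fine_probability ?ltW//; exact: measurable_unseparated.
have moment i C' : measurable C' -> windowed s C' -> exists m : R,
    (\int[iid eta]_z (labelled_mass (p n) z (C i) * labelled_mass (p n) z C')%:E = m%:E)%E /\
    `|m - fine (kappa (C i)) * fine (kappa C')| <= b.
  move=> mC' wC'.
  have [m Em mb] := labelled_mass_moment (mp n) (mC i) mC' (wC i) wC'.
  by exists m; split => //; exact: le_trans mb bn.
have /choice[m1 m1E] i := moment i setT measurableT (fun _ _ _ _ _ => id).
have /choice[m2 m2E] i := moment i (C i) (mC i) (wC i).
have kT : fine (kappa setT) = 1 by exact: (congr1 fine (probability_setT kappa)).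
exists (p n).
suff [z hz] : exists z, forall i, `|labelled_mass (p n) z (C i) - fine (kappa (C i))| < e.
  by exists z.
apply: (exists_small_deviation (P := iid eta) (X := fun i z => labelled_mass (p n) z (C i))
  (k := fun i => fine (kappa (C i))) (m1 := m1) (m2 := m2) (b := b)) => //.
- by move=> i; exact: measurable_labelled_mass.
- by move=> i z; exact: fine_ge0.
- move=> i; rewrite fine_ge0//= -lee_fin fine_probability//.
  exact: probability_le1.
- move=> i; have [<- _] := m1E i.
  by apply: eq_integral => z _; rewrite labelled_massT mulr1.
- by move=> i; have [] := m2E i.
- move=> i; have [_] := m1E i.
  by have /= -> := congr1 (fun r => fine (kappa (C i)) * r) kT; rewrite mulr1.
- by move=> i; have [] := m2E i.
have -> : #|I|%:R * (3 * b) = e ^+ 2 * (#|I|%:R / #|I|.+1%:R).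
  by rewrite /b; field; rewrite ?natr1 ?nat1r pnatr_eq0.
by rewrite gtr_pMr ?exprn_gt0// ltr_pdivrMr// mul1r ltr_nat.
Qed.

End exists_labelling.

(** * Weak containment *)

Section actions.
Context (R : realType) (G : groupType) d (T : measurableType d) (b : mp_action R G T).
Implicit Types (A B E : set T).

Lemma act_image g A : b g @` A = b g^-1%g @^-1` A.
Proof.
apply/seteqP; split => [_ [y Ay <-]|y Ay] /=; first by rewrite -actM mulVg act1.
by exists (b g^-1%g y) => //; rewrite -actM mulgV act1.
Qed.

Lemma measurable_act_image g A : measurable A -> measurable (b g @` A).
Proof.
by move=> mA; rewrite act_image -[X in measurable X]setTI; exact: measurable_act.
Qed.

Lemma act_image_measure g A : measurable A ->
  mp_measure b (b g @` A) = mp_measure b A.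
Proof. by move=> mA; rewrite act_image act_preserving. Qed.

(** The two intersections agree outside the union of gE and E, and gE has the measure of E. *)
Lemma act_image_agree_off g A A' B B' E :
  measurable A -> measurable A' -> measurable B -> measurable B' -> measurable E ->
  (forall x, ~ E x -> A x <-> A' x) -> (forall x, ~ E x -> B x <-> B' x) ->
  `|fine (mp_measure b (b g @` A `&` B)) - fine (mp_measure b (b g @` A' `&` B'))| <=
  fine (mp_measure b E) + fine (mp_measure b E).
Proof.
move=> mA mA' mB mB' mE AA' BB'.
have mgE : measurable (b g @` E) by exact: measurable_act_image.
apply: (@le_trans _ _ (fine (mp_measure b (b g @` E `|` E)))).
  apply: probability_agree_off.
  - by apply: measurableI => //; exact: measurable_act_image.
  - by apply: measurableI => //; exact: measurable_act_image.
  - exact: measurableU.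
  rewrite !act_image => x /= /not_orP[/AA' h1 /BB' h2].
  by split => -[h3 h4]; split; [exact/h1|exact/h2|exact/h1|exact/h2].
rewrite -lee_fin EFinD !fine_probability//; last exact: measurableU.
apply: (@le_trans _ _ (mp_measure b (b g @` E) + mp_measure b E)%E).
  exact: measureU2.
by rewrite act_image_measure.
Qed.

End actions.

Section weak_containment_theory.
Context (R : realType) (G : groupType) dX dY dT (X : measurableType dX)
  (Y : measurableType dY) (T : measurableType dT).

Lemma measurable_partition_preimage (f : Y -> X) k (A : 'I_k -> set X) :
  measurable_fun setT f -> measurable_partition A ->
  measurable_partition (fun i => f @^-1` A i).
Proof.
move=> mf [mA tA cA]; split.
- by move=> i; rewrite -[X in measurable X]setTI; exact: mf.
- by move=> i j _ _ [y [Ai Aj]]; apply: tA => //; exists (f y).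
- apply/seteqP; split => // y _; have : setT (f y) by [].
  by rewrite -cA => -[i _ Ai]; exists i.
Qed.

(** The pulled-back partition has exactly the same intersection measures. *)
Lemma weakly_contained_factor (a : mp_action R G X) (b : mp_action R G Y) (f : Y -> X) :
  measurable_fun setT f -> (forall g y, f (b g y) = a g (f y)) ->
  (forall A, measurable A -> mp_measure b (f @^-1` A) = mp_measure a A) ->
  weakly_contained a b.
Proof.
move=> mf fE muf k A pA F e e0; exists (fun i => f @^-1` A i).
  exact: measurable_partition_preimage.
move=> g _ i j; have [mA _ _] := pA.
rewrite -(muf (a g @` A i `&` A j)); last first.
  by apply: measurableI => //; exact: measurable_act_image.
rewrite (_ : f @^-1` _ = b g @` (f @^-1` A i) `&` f @^-1` A j) ?subrr ?normr0//.
by rewrite !act_image; apply/seteqP; split => y /=; rewrite fE.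
Qed.

Lemma weakly_contained_trans (a : mp_action R G X) (b : mp_action R G Y)
    (c : mp_action R G T) :
  weakly_contained a b -> weakly_contained b c -> weakly_contained a c.
Proof.
move=> ab bc k A pA F e e0; have e20 : 0 < e / 2 by rewrite divr_gt0.
have [B pB AB] := ab k A pA F _ e20; have [C pC BC] := bc k B pB F _ e20.
exists C => // g gF i j; apply: le_lt_trans (ler_distD _ _ _) _; last first.
  by rewrite [ltRHS]splitr; apply: ltrD; [exact: AB gF i j|exact: BC gF i j].
Qed.

End weak_containment_theory.

(** * Weak containment of the joining in the action *)

Section joining.
Context (R : realType) (G : countGroupType) dY (Y : measurableType dY)
  (hY : standard_borel R Y) (a : mp_action R G Y) dZ (Z : measurableType dZ)
  (eta : probability Z R).
Local Notation X := (coset_fspace G Z).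
Local Notation nu := (mp_measure a).
Local Notation kappa := (joining_measure a hY eta).
Local Notation b := (relatively_independent_joining a hY eta).

(** An algebra playing the role of the cylinder sets. *)
Definition finitely_windowed : set (set (X * Y)) :=
  [set C | measurable C /\ exists s, windowed s C].

Lemma finitely_windowedT : finitely_windowed setT.
Proof. by split => //; exists [::]. Qed.

Lemma finitely_windowedC C : finitely_windowed C -> finitely_windowed (~` C).
Proof.
by move=> [mC [s wC]]; split; [exact: measurableC|exists s; exact: windowedC].
Qed.

Lemma finitely_windowedI C C' : finitely_windowed C -> finitely_windowed C' ->
  finitely_windowed (C `&` C').
Proof.
move=> [mC [s wC]] [mC' [s' wC']]; split; first exact: measurableI.
exists (s ++ s'); apply: windowedI; [apply: sub_windowed wC|apply: sub_windowed wC'];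
  by move=> g gs; rewrite mem_cat gs ?orbT.
Qed.

Lemma finitely_windowed_generate :
  (measurable : set (set (X * Y))) `<=` <<s finitely_windowed >>.
Proof.
(* It suffices that the identity is measurable from the sigma-algebra on the
   right, which only involves the coordinates. *)
pose T := g_sigma_algebraType finitely_windowed.
have sub C : finitely_windowed C -> @measurable _ T C by exact: sub_sigma_algebra.
have mid : @measurable_fun _ _ T (X * Y)%type setT (fun t => (t.1, t.2)).
  apply: measurable_fun_pair.
    apply: coset_fspace_measurable_fun.
      move=> g _ B mB; rewrite setTI; apply: sub; split.
        rewrite -[X in measurable X]setTI.
        exact: (measurableT_comp (@measurable_coset_eval G _ Z g) measurable_fst).
      by exists [:: g] => f f' y _ /(_ g (mem_head _ _)) /= ->.
    apply: subgroup_measurable_fun => g; apply: sub; split.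
      have mb : measurable_fun setT (fun t : X * Y => base t.1).
        exact: (measurableT_comp (@measurable_base G _ Z) measurable_fst).
      by have := mb measurableT _ (measurable_subgroup_mem g); rewrite setTI.
    by exists [::] => f f' y ff' _ /=; rewrite ff'.
  move=> _ B mB; rewrite setTI; apply: sub; split.
    by rewrite -[X in measurable X]setTI; exact: measurable_snd.
  by exists [::].
move=> C mC; have := mid measurableT C mC; rewrite setTI.
by congr (<<s _ >> _); apply/seteqP; split => -[].
Qed.

Lemma joining_weakly_contained : non_atomic nu -> weakly_contained b a.
Proof.
move=> na k A pA F e e0.
(* Replacing A by A' costs twice the measure of [E], less than e/2; the choice of z costs the other
   e/2. *)
have e40 : 0 < e / 2 / 2 by rewrite !divr_gt0.
have [A' [E [pA' wA' mE Ee AA']]] := approximate_partition kappa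
  finitely_windowedT finitely_windowedC finitely_windowedI
  (fun C (wC : finitely_windowed C) => wC.1) finitely_windowed_generate pA e40.
have [mA _ _] := pA; have [mA' _ _] := pA'.
have [s0 ws0] : exists s0, forall i, windowed s0 (A' i).
  have /choice[s ws] : forall i, exists s, windowed s (A' i).
    by move=> i; have [_] := wA' i.
  exists (flatten [seq s i | i <- enum 'I_k]) => i; apply: sub_windowed (ws i).
  move=> g gs; apply/flatten_mapP; exists i => //; by rewrite mem_enum.
(* The image of A' i under g has window g s0, so [s] serves all the sets [C u] at once. *)
pose s := s0 ++ flatten [seq [seq (g * c)%g | c <- s0] | g <- F].
pose C (u : seq_sub F * ('I_k * 'I_k)) := b (val u.1) @` A' u.2.1 `&` A' u.2.2.
have mC u : measurable (C u).
  by apply: measurableI => //; exact: measurable_act_image.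
have wC u : windowed s (C u).
  apply: windowedI; last first.
    by apply: sub_windowed (ws0 _) => g gs; rewrite mem_cat gs.
  have ss : {subset [seq ((val u.1)^-1^-1 * c)%g | c <- s0] <= s}.
    move=> g gs; rewrite mem_cat; apply/orP; right; apply/flatten_mapP.
    by exists (val u.1); [exact: valP|rewrite invgK in gs].
  rewrite act_image.
  exact: (sub_windowed ss (windowed_act (a := a) (g := (val u.1)^-1%g) (ws0 u.2.1))).
have e20 : 0 < e / 2 by rewrite divr_gt0.
have [p [z [mp hz]]] := exists_labelling hY eta na mC wC e20.
exists (fun i => labelled_point a p z @^-1` A' i).
  by apply: measurable_partition_preimage => //; exact: measurable_labelled_point1.
move=> g gF i j.
have := hz (SeqSub gF, (i, j)); rewrite /labelled_mass.
(* By equivariance of Phi_z. *)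
have -> : labelled_point a p z @^-1` C (SeqSub gF, (i, j)) =
    a g @` (labelled_point a p z @^-1` A' i) `&` labelled_point a p z @^-1` A' j.
  rewrite /C !act_image; apply/funext => y /=.
  by congr and; rewrite labelled_point_act.
move=> hgij; apply: le_lt_trans (ler_distD (fine (kappa (C (SeqSub gF, (i, j))))) _ _) _.
rewrite [ltRHS]splitr; apply: ltrD; last by rewrite distrC.
apply: le_lt_trans (act_image_agree_off b g (mA i) (mA' i) (mA j) (mA' j) mE
  (fun x nE => AA' x nE i) (fun x nE => AA' x nE j)) _.
by rewrite [ltRHS]splitr; apply: ltrD; rewrite -lte_fin fine_probability.
Qed.

End joining.

Unset Implicit Arguments.

Theorem theorem1p5 (R : realType) (G : countGroupType) (theta : IRS R G)
    (dZ : measure_display) (Z : measurableType dZ) (eta : probability Z R)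
    (hZ : standard_borel R Z) :
  (forall (dY : measure_display) (Y : measurableType dY)
      (hY : standard_borel R Y) (a : mp_action R G Y),
    non_atomic (mp_measure a) ->
    (forall A : set (subgroup G), measurable A -> mp_type a hY A = theta A) ->
    weakly_equivalent (relatively_independent_joining a hY eta) a) /\
  (forall (dY : measure_display) (Y : measurableType dY)
      (hY : standard_borel R Y) (a : mp_action R G Y),
    non_atomic (mp_measure a) ->
    (forall A : set (subgroup G), measurable A -> mp_type a hY A = theta A) ->
    weakly_contained (random_bernoulli_shift theta eta) a).
Proof.
split=> dY Y hY a na tE.
  split; first exact: joining_weakly_contained.
  (* The second marginal of the joining is nu: the section at y of the preimage of A is everything
     or empty, according to whether y is in A. *)
  apply: (weakly_contained_factor (f := snd)) => // A mA.
  rewrite [LHS](joining_measure_ysection hY a eta); last first.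
    by rewrite -[X in measurable X]setTI; exact: measurable_snd.
  transitivity (\int[mp_measure a]_y (\1_A y)%:E)%E; last first.
    by rewrite integral_indic// setIT.
  apply: eq_integral => y _.
  rewrite indicE; have [/set_mem Ay|/negP nAy] := boolP (y \in A).
    rewrite (_ : ysection _ _ = setT) ?probability_setT//.
    by apply/seteqP; split => // f _; rewrite /ysection /= inE.
  rewrite (_ : ysection _ _ = set0) ?measure0//.
  rewrite -subset0 => f; rewrite /ysection /= inE /= => Ay; apply: nAy.
  exact/mem_set.
(* The random shift is a factor of the joining through the first projection. *)
apply: weakly_contained_trans (joining_weakly_contained hY eta na).
apply: (weakly_contained_factor (f := fst)) => // A mA.
rewrite [LHS](joining_measure_ysection hY a eta); last first.
  by rewrite -[X in measurable X]setTI; exact: measurable_fst.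
rewrite [RHS]random_bernoulli_measureE.
transitivity (\int[mp_measure a]_y bernoulli_at eta (stabilizer a y) A)%E.
  apply: eq_integral => y _; congr (bernoulli_at eta _ _).
  by apply/seteqP; split => f; rewrite /ysection /= inE.
(* The type hypothesis turns the integral over y into one over subgroups, as theta is the image of
   nu under the stabilizer map. *)
have ms := measurable_stabilizer a hY.
rewrite -(@ge0_integral_pushforward _ _ _ _ _ _ ms (mp_measure a) setT
  (fun H => bernoulli_at eta H A))//; last exact: measurable_bernoulli_at.
by apply: eq_measure_integral => B mB _; exact: tE.
Qed.
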